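(* Let $X=(X(t))_{t\ge 0}$ be a spectrally positive Lévy process and $Y=(Y(t))_{t\ge 0}$ a spectrally negative Lévy process, both real valued, with infinite variation and without Gaussian (Wiener) component. Assume that for each of the two processes the Lévy measure has a bounded density on every infinite interval cut off from zero (i.e. on $(-\infty,-\varepsilon)$ and on $(\varepsilon,\infty)$ for every $\varepsilon>0$), and that for every $s>0$ the one-dimensional distributions of $X(s)$ and $Y(s)$ are absolutely continuous with respect to Lebesgue measure. Let $t>0$. Then $$\mathbb{E}\sup_{s\le t}X(s)=\int_0^{\infty}\mathbb{P}(X(t)>u)\,du+\int_0^t\frac{\mathbb{P}(X(t-s)>0)}{s}\left(\int_{-\infty}^{0}\mathbb{P}(X(s)\le u)\,du\right)ds .$$ If moreover $\mathbb{E}\,Y^{-}(t)<\infty$, then $$\mathbb{E}\sup_{s\le t}Y(s)=\int_0^{\infty}\mathbb{P}(Y(t)>u)\,du+\int_0^t\frac{\mathbb{P}(Y(t-s)<0)}{s}\left(\int_{0}^{\infty}\mathbb{P}(Y(s)\ge u)\,du\right)ds .$$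
   Context: A Lévy process starts at $0$, has independent and stationary increments and càdlàg paths. It is spectrally positive if it has no negative jumps and spectrally negative if it has no positive jumps. The supremum $\sup_{s\le t}$ is over $s\in[0,t]$. For real $x$, $x^{-}=-\min(x,0)$, and $Y^{-}(t)=(Y(t))^{-}$. The expectations and the integrals of nonnegative functions in the formulas are understood as elements of $[0,\infty]$. *)

(* Defs.v *)
From mathcomp Require Export all_boot all_order all_algebra.
From mathcomp Require Export all_classical all_reals all_analysis.

Set Implicit Arguments.
Unset Strict Implicit.
Unset Printing Implicit Defensive.

Import Order.TTheory GRing.Theory Num.Theory.
Import numFieldNormedType.Exports.

Local Open Scope classical_set_scope.
Local Open Scope ring_scope.

Section levy.
Context (d : measure_display) (T : measurableType d) (R : realType).
Variable P : probability T R.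

(* Processes are indexed by R, but only their restriction to [0, +oo[ is ever
   constrained or used. *)
Implicit Type X : R -> {RV P >-> R}.

Definition increment X (s t : R) : T -> R := fun w => X t w - X s w.

(* The product rule for the subfamilies is the case where some B i are setT. *)
Definition independent_increments X :=
  forall (n : nat) (t : nat -> R) (B : nat -> set R),
    0 <= t 0%N -> {homo t : i j / (i <= j)%N >-> i <= j} ->
    (forall i, measurable (B i)) ->
    P (\bigcap_(i in `I_n) (increment X (t i) (t i.+1) @^-1` B i)) =
    (\prod_(i < n) P (increment X (t i) (t i.+1) @^-1` B i))%E.

Definition stationary_increments X :=
  forall (s t : R) (B : set R), 0 <= s -> s <= t -> measurable B ->
    P (increment X s t @^-1` B) = P (X (t - s) @^-1` B).

Definition path X (w : T) : R -> R := fun t => X t w.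

Definition cadlag (f : R -> R) :=
  (forall t, 0 <= t -> f s @[s --> t^'+] --> f t) /\
  (forall t, 0 < t -> cvg (f s @[s --> t^'-])).

Definition jump (f : R -> R) (t : R) : R := f t - lim (f s @[s --> t^'-]).

Record levy_process X : Prop := LevyProcess {
  levy_start : {ae P, forall w, X 0 w = 0} ;
  levy_independent : independent_increments X ;
  levy_stationary : stationary_increments X ;
  levy_cadlag : forall w, cadlag (path X w) }.

Definition spectrally_positive X :=
  {ae P, forall w, forall t, 0 < t -> 0 <= jump (path X w) t}.

Definition spectrally_negative X :=
  {ae P, forall w, forall t, 0 < t -> jump (path X w) t <= 0}.

Definition infinite_variation X :=
  forall t, 0 < t -> {ae P, forall w, total_variation 0 t (path X w) = +oo%E}.

Definition levy_measure (nu : {measure set R -> \bar R}) :=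
  nu [set 0] = 0%E /\ (\int[nu]_x (Num.min 1 (x ^+ 2))%:E < +oo)%E.

(* Real and imaginary parts of the characteristic exponent
   i b u - sigma2 u^2 / 2 + \int (e^(iux) - 1 - iux 1_{|x| <= 1}) nu(dx). *)
Definition re_exponent (sigma2 : R) (nu : {measure set R -> \bar R}) (u : R) :=
  - (sigma2 * u ^+ 2 / 2) + \int[nu]_x (cos (u * x) - 1).

Definition im_exponent (b : R) (nu : {measure set R -> \bar R}) (u : R) :=
  b * u + \int[nu]_x (sin (u * x) - u * x * \1_`[-1, 1] x).

(* (b, sigma2, nu) is the Levy-Khintchine triplet of X, i.e.
   E e^(iuX(t)) = e^(t psi(u)); sigma2 is the variance of the Gaussian
   component and nu is the Levy measure of X. *)
Definition levy_triplet X (b sigma2 : R) (nu : {measure set R -> \bar R}) :=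
  [/\ 0 <= sigma2, levy_measure nu &
   forall t u : R, 0 <= t ->
     ('E_P[fun w => cos (u * X t w)])%E =
       (expR (t * re_exponent sigma2 nu u) * cos (t * im_exponent b nu u))%:E
     /\
     ('E_P[fun w => sin (u * X t w)])%E =
       (expR (t * re_exponent sigma2 nu u) * sin (t * im_exponent b nu u))%:E].

Definition bounded_density_on (nu : {measure set R -> \bar R}) (D : set R) :=
  exists f : R -> R, exists M : R,
    [/\ measurable_fun D f, (forall x, D x -> 0 <= f x <= M) &
     forall A, measurable A -> A `<=` D ->
       nu A = (\int[lebesgue_measure]_(x in A) (f x)%:E)%E].

Definition bounded_density_off_zero (nu : {measure set R -> \bar R}) :=
  forall eps : R, 0 < eps ->
    bounded_density_on nu (`]-oo, (- eps)[) /\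
    bounded_density_on nu (`]eps, +oo[).

Definition running_sup X (t : R) : T -> \bar R :=
  fun w => ereal_sup [set (X s w)%:E | s in `[0, t]].

End levy.

(* Main.v *)
From HB Require Import structures.
Require Import Defs.
From mathcomp Require Import all_boot all_order all_algebra.
From mathcomp Require Import all_classical all_reals all_analysis.
From mathcomp Require Import perm measurable_realfun ring lra.

Set Implicit Arguments.
Unset Strict Implicit.
Unset Printing Implicit Defensive.

Import Order.TTheory GRing.Theory Num.Theory.
Import numFieldNormedType.Exports.

Local Open Scope classical_set_scope.
Local Open Scope ring_scope.
Local Open Scope ereal_scope.

(** Let Z be a spectrally positive Levy process with Z(0) = 0, put
    a(s) = E Z(s)^- and let D(t) be the supremum of - Z over [0, t], the
    depth of Z.  Both formulas come from one identity ([expected_depthE]):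

      E D(t) = a(t) + \int_0^t P(Z(t - s) > 0) a(s) / s ds.

    Take X and Y centred at time 0.  For Z = - Y the depth is the supremum of Y,
    and the identity is the second formula.  For Z = X, reversing the order of
    the increments gives sup X the law of X(t) + D(t), so that
    E sup X + a(t) = E X(t)^+ + E D(t) ([expected_sup_reversal]), and the finite
    a(t) cancels.

    The identity is proved on the grid of the points k h with h = t / 2^n.  Let
    L_k be the minimum of Z over the first k + 1 grid points.

    - A rotation of the first k increments does not change their law, and over
      all k rotations the falls L_(k-1) - L_k add up to Z(k h)^-
      ([sum_cyclic_drop]).  Hence E (L_(k-1) - L_k) = a(k h) / k
      ([expected_new_low]), which is Spitzer's identity.
    - The fall at step k is independent of Z(t) - Z(k h).  So the sum over k of
      the falls after which Z ends higher, Z(t) > Z(k h), has expectation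
      \sum_k P(Z(t - k h) > 0) a(k h) / k, a Riemann sum of the integral.
    - For each path, that sum is the length of the part of [L_N, 0] below Z(t),
      up to the one fall that crosses the level Z(t).  Without negative jumps
      no fall is large on a fine grid, so the sum tends to D(t) - Z(t)^-
      ([sum_drops_endpoint], [cvg_sum_late_low]).

    Two estimates justify the passage to the limit.  A path without negative
    jumps passes each level almost exactly, which makes the tail of D(t)
    submultiplicative ([tail_submultiplicative]), hence geometric, so E D(t) is
    finite ([expected_depth_lty]) and dominates everything.  And since a(s) / s
    may be unbounded near 0, the sum is cut at a time e: the falls before e
    contribute at most E D(e) ([expected_depth_bounds]), which vanishes with e
    ([cvg_expected_depth0]). *)

(** * Running minima of finite sequences *)

Section running_min.
Context {R : realType}.
Implicit Types (f g : nat -> R).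

Fixpoint running_min f k : R :=
  if k is k'.+1 then Num.min (running_min f k') (f k) else f 0%N.

Lemma eq_running_min f g k : (forall i, (i <= k)%N -> f i = g i) ->
  running_min f k = running_min g k.
Proof.
elim: k => [|k IH] fg /=; first exact: fg.
by rewrite fg// IH// => i ik; rewrite fg// (leq_trans ik).
Qed.

Lemma running_min_le f k i : (i <= k)%N -> (running_min f k <= f i)%R.
Proof.
elim: k => [|k IH] /=; first by rewrite leqn0 => /eqP ->.
by rewrite leq_eqVlt ltnS ge_min => /orP[/eqP ->|/IH ->//]; rewrite lexx orbT.
Qed.

Lemma running_minP f k : exists2 i, (i <= k)%N & running_min f k = f i.
Proof.
elim: k => [|k [i ik IH]] /=; first by exists 0%N.
have [_|_] := leP (running_min f k) (f k.+1); last by exists k.+1.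
by exists i => //; exact: leqW.
Qed.

Lemma running_min_recl f k :
  running_min f k.+1 = Num.min (f 0%N) (running_min (fun i => f i.+1) k).
Proof. by elim: k => //= k ->; rewrite minA. Qed.

Lemma running_minS_le f k : (running_min f k.+1 <= running_min f k)%R.
Proof. by rewrite /= ge_min lexx. Qed.

Lemma running_min_homo f m n : (m <= n)%N ->
  (running_min f n <= running_min f m)%R.
Proof.
move=> /subnK <-; elim: (n - m)%N => // k IH.
by rewrite addSn (le_trans _ IH)// running_minS_le.
Qed.

Lemma running_min_drop f k :
  (running_min f k - running_min f k.+1)%R =
  Num.max 0%R (running_min f k - f k.+1)%R.
Proof.
rewrite /=; have [fk|fk] := leP (running_min f k) (f k.+1).
  by rewrite subrr max_l// subr_le0.
by rewrite max_r// subr_ge0 ltW.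
Qed.

Lemma running_minD f k c :
  running_min (fun i => f i + c)%R k = (running_min f k + c)%R.
Proof. by elim: k => //= k ->; rewrite addr_minl. Qed.

(** The sequence [f] is periodic up to a drift [s] per period.  If [s <= 0],
    then [f (j + k.+1)] lies below [f j], so sliding the window by one step
    replaces its minimum by the smaller of that minimum and the new endpoint:
    the summands are the falls of the sliding minimum and telescope.  If
    [0 < s], no new endpoint is a minimum. *)
Lemma sum_cyclic_drop f k s : (forall m, f (m + k.+1)%N = f m + s)%R ->
  (\sum_(j < k.+1) Num.max 0 (running_min (fun i => f (j + i)%N) k - f (j + k.+1)%N)
   = Num.max 0 (- s))%R.
Proof.
move=> fs; pose W j := running_min (fun i => f (j + i)%N) k.
have [s0|s0] := leP s 0%R.
  rewrite max_r ?oppr_ge0//.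
  transitivity (\sum_(j < k.+1) (W j - W j.+1))%R.
    apply: eq_bigr => j _; rewrite -running_min_drop -/(W j); congr (_ - _)%R.
    rewrite running_min_recl addn0 min_r.
      by apply: eq_running_min => i _; rewrite addSnnS.
    rewrite (@le_trans _ _ (f (j + k.+1)%N))//.
      exact: (running_min_le (fun i => f (j + i.+1)%N) (leqnn k)).
    by rewrite fs gerDl.
  rewrite -(big_mkord xpredT (fun j => W j - W j.+1)%R).
  under eq_bigr do rewrite -opprB.
  rewrite sumrN telescope_sumr//.
  have -> : W k.+1 = (W 0%N + s)%R.
    rewrite /W -running_minD; apply: eq_running_min => i _.
    by rewrite add0n addnC fs.
  lra.
have -> : (Num.max 0 (- s) = 0)%R by rewrite max_l// oppr_le0 ltW.
apply: big1 => j _.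
rewrite max_l// subr_le0 fs -[leLHS]addr0 lerD//; last exact: ltW.
by have := running_min_le (fun i => f (j + i)%N) (leq0n k); rewrite addn0.
Qed.

Definition walk (x : seq R) k : R := (\sum_(0 <= i < k) x`_i)%R.

Lemma walk0 x : walk x 0 = 0%R. Proof. by rewrite /walk big_geq. Qed.

Lemma walkS x k : walk x k.+1 = (walk x k + x`_k)%R.
Proof. by rewrite /walk big_nat_recr. Qed.

(** The cyclic shift by [j], as addition in the group of integers modulo
    [n.+1]. *)
Definition rot_perm n j : {perm 'I_n.+1} :=
  perm (can_inj (addrK (inord j : 'I_n.+1))).

Lemma walk_rot n (x : n.+1.-tuple R) j k : (j < n.+1)%N -> (k <= n.+1)%N ->
  let f m := (\sum_(0 <= i < m) x`_(i %% n.+1))%R in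
  walk [tuple tnth x (rot_perm n j i) | i < n.+1] k = (f (j + k)%N - f j)%R.
Proof.
move=> jn kn /=.
have jjk : (j <= j + k)%N by rewrite leq_addr.
rewrite (big_cat_nat (leq0n j) jjk)/= addrAC subrr add0r.
rewrite -{1}[j in RHS]add0n [(j + k)%N]addnC big_addn addnK.
rewrite /walk !big_nat; apply: eq_bigr => i /andP[_ ik].
have i_n := leq_trans ik kn.
transitivity (tnth [tuple tnth x (rot_perm n j i) | i < n.+1] (Ordinal i_n)).
  by rewrite (tnth_nth 0%R).
rewrite tnth_mktuple permE (tnth_nth 0%R); congr (_`_ _)%R => /=.
by rewrite inordK.
Qed.

(** The walks of the rotations of [x] are the windows of the walk of the
    periodic extension of [x], which drifts by [walk x n.+1] per period. *)
Lemma sum_rot_drop n (x : n.+1.-tuple R) :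
  (\sum_(j < n.+1)
    (let y := [tuple tnth x (rot_perm n j i) | i < n.+1] in
     Num.max 0 (running_min (walk y) n - walk y n.+1))
  = Num.max 0 (- walk x n.+1))%R.
Proof.
pose f m := (\sum_(0 <= i < m) x`_(i %% n.+1))%R.
have fS m : f (m + n.+1)%N = (f m + walk x n.+1)%R.
  have f0 : f n.+1 = walk x n.+1.
    rewrite /f /walk !big_nat; apply: eq_bigr => i /andP[_ ik].
    by rewrite modn_small.
  elim: m => [|m IH]; first by rewrite add0n f0 /f big_geq ?add0r.
  rewrite addSn /f big_nat_recr//= -/(f (m + n.+1)%N) IH big_nat_recr//=.
  rewrite modnDr -/(f m); lra.
rewrite -(sum_cyclic_drop fS); apply: eq_bigr => j _ /=.
rewrite [walk _ n.+1]walk_rot// -/(f _) -/(f _); congr (Num.max 0 _)%R.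
have -> : running_min (walk [tuple tnth x (rot_perm n j i)  | i < n.+1]) n =
   (running_min (fun i => f (j + i)%N) n + - f j)%R.
  rewrite -running_minD; apply: eq_running_min => i i_n.
  by rewrite walk_rot// (leq_trans i_n).
lra.
Qed.

End running_min.

Section drops_below_endpoint.
Context {R : realType}.
Local Close Scope ereal_scope.
Variables (f : nat -> R).
Hypothesis f0 : f 0%N = 0.

Let low := running_min f.

Lemma sum_drops n : \sum_(k < n) (low k - low k.+1) = - low n.
Proof.
elim: n => [|n IH]; first by rewrite big_ord0 /low /= f0 oppr0.
by rewrite big_ord_recr/= IH; lra.
Qed.

Let Jle0 n : low n <= 0.
Proof. by rewrite -f0; exact: running_min_le. Qed.

(** The fall that crosses the level [c] is counted in full although only the
    part of it below [c] should be; that fall is at most [e]. *)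
Lemma sum_drops_below c e n : c <= 0 -> 0 <= e ->
  (forall k, (k < n)%N -> f k - e <= f k.+1) ->
  let D := \sum_(k < n) (low k - low k.+1) * (low k.+1 < c)%R%:R in
  if c <= low n then D = 0 else c - low n <= D <= c - low n + e.
Proof.
move=> c0 e0; elim: n => [|n IH] fe /=.
  by rewrite /low/= f0 c0 big_ord0.
have {}IH := IH (fun k kn => fe k (ltnW kn)).
have dropS : low n - low n.+1 <= e.
  rewrite running_min_drop ge_max e0/=.
  have := fe n (leqnn _); have := running_min_le f (leqnn n).
  by rewrite -/(low n); lra.
have := running_minS_le f n; rewrite -/(low n) -/(low n.+1) => JS.
rewrite big_ord_recr/=; move: IH.
set D := \sum_(_ < n) _.
rewrite [low n.+1 < c]ltNge; case: (leP c (low n.+1)) => cJS /=.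
  by rewrite (le_trans cJS JS) => ->; rewrite mulr0 addr0.
rewrite mulr1; case: (leP c (low n)) => cJ.
  by move=> ->; apply/andP; split; lra.
by move=> /andP[? ?]; apply/andP; split; lra.
Qed.

(** At a new minimum [low k.+1 = f k.+1], so the condition on [f k.+1] is a
    condition on the level reached.  As every level reached is negative, the
    threshold [f n] may be replaced by [Num.min (f n) 0]. *)
Lemma sum_drops_endpoint e n : 0 <= e ->
  (forall k, (k < n)%N -> f k - e <= f k.+1) ->
  - low n <= \sum_(k < n) (low k - low k.+1) * (f k.+1 < f n)%R%:R + Num.max 0 (- f n)
        <= - low n + e.
Proof.
move=> e0 fe; pose c := Num.min (f n) 0.
have c0 : c <= 0 by rewrite /c ge_min lexx orbT.
have := sum_drops_below c0 e0 fe.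
rewrite (_ : \sum_(k < n) (low k - low k.+1) * (low k.+1 < c)%R%:R =
             \sum_(k < n) (low k - low k.+1) * (f k.+1 < f n)%R%:R); last first.
  apply: eq_bigr => k _.
  have [fJ|Jf] := leP (low k) (f k.+1).
    by rewrite /low /= (min_l fJ) subrr !mul0r.
  have JS : low k.+1 = f k.+1 by rewrite /low /= min_r// ltW.
  by rewrite JS /c lt_min (lt_le_trans Jf (Jle0 k)) andbT.
have -> : Num.max 0 (- f n) = - c.
  by rewrite /c; case: (leP (f n) 0) => fn0; rewrite ?(min_l fn0)?(min_r (ltW fn0));
     [rewrite max_r ?oppr_ge0|rewrite oppr0 max_l// oppr_le0 ltW].
move=> /=; have [cJ|cJ] := leP c (low n).
  have : low n <= c by rewrite /c le_min Jle0 andbT; exact: running_min_le.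
  by move=> ? ->; apply/andP; split; lra.
by move=> /andP[? ?]; apply/andP; split; lra.
Qed.

Lemma sum_early_drops (P : pred nat) n : (forall i j, (i <= j)%N -> P j -> P i) ->
  P 0%N -> exists2 K, (K <= n)%N && P K & \sum_(k < n | P k.+1) (low k - low k.+1) <= - low K.
Proof.
move=> Pdown P0; elim: n => [|n [K /andP[Kn PK] IH]].
  by exists 0%N; rewrite ?P0// big_ord0 oppr_ge0.
have [Pn|Pn] := boolP (P n.+1).
  exists n.+1; rewrite ?leqnn ?Pn//.
  rewrite -sum_drops [leRHS](bigID (fun k : 'I_n.+1 => P k.+1))/= lerDl.
  by apply: sumr_ge0 => k _; rewrite subr_ge0 running_minS_le.
exists K; first by rewrite (leqW Kn).
by rewrite big_mkcond big_ord_recr/= (negbTE Pn) addr0 -big_mkcond.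
Qed.

End drops_below_endpoint.

(** * Laws of random tuples *)

Section tuple_laws.
Context {R : realType} {n : nat}.

Definition box (B : 'I_n -> set R) : set (n.-tuple R) :=
  [set x | forall i, B i (tnth x i)].

Definition boxes : set (set (n.-tuple R)) :=
  [set A | exists2 B : 'I_n -> set R, (forall i, measurable (B i)) & A = box B].

Lemma boxE (B : 'I_n -> set R) :
  box B = \bigcap_(i in [set: 'I_n]) ((fun x => tnth x i) @^-1` B i).
Proof. by apply/seteqP; split=> x /= Bx i; [move=> _; exact: Bx|exact: Bx]. Qed.

Lemma measurable_box (B : 'I_n -> set R) :
  (forall i, measurable (B i)) -> measurable (box B).
Proof.
move=> mB; rewrite boxE; apply: fin_bigcap_measurable => // i _.
by rewrite -[X in measurable X]setTI; exact: measurable_tnth.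
Qed.

Lemma setI_closed_boxes : setI_closed boxes.
Proof.
move=> _ _ [B mB ->] [C mC ->]; exists (fun i => B i `&` C i).
  by move=> i; exact: measurableI.
by apply/seteqP; split => x /= => [[xB xC] i|xBC]; split => // i;
  have [] := xBC i.
Qed.

(** Boxes form a pi-system that generates the product sigma-algebra, whence the
    uniqueness principle below. *)
Lemma measurable_tupleE : measurable = <<s boxes >>.
Proof.
apply/seteqP; split.
  apply: smallest_sub; first exact: smallest_sigma_algebra.
  rewrite -bigcup_seq => A [i _ [C mC <-]]; apply: sub_sigma_algebra.
  exists (fun j => if j == i then C else setT).
    by move=> j; case: ifP.
  rewrite setTI; apply/seteqP; split => x /=.
    by move=> Cx j; case: ifPn => // /eqP ->.
  by move=> /(_ i); rewrite eqxx.
apply: smallest_sub; first exact: sigma_algebra_measurable.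
by move=> A [B mB ->]; exact: measurable_box.
Qed.

Lemma tuple_measure_unique (m1 m2 : {measure set (n.-tuple R) -> \bar R}) :
  m1 setT < +oo ->
  (forall B : 'I_n -> set R, (forall i, measurable (B i)) ->
    m1 (box B) = m2 (box B)) ->
  forall A, measurable A -> m1 A = m2 A.
Proof.
move=> m1oo m12.
apply: (measure_unique boxes (fun=> setT)) => //.
- exact: measurable_tupleE.
- exact: setI_closed_boxes.
- by move=> _; exists (fun=> setT) => //; apply/seteqP; split.
- by apply/seteqP; split => // x _; exists 0%N.
- by move=> _ [B mB ->]; exact: m12.
Qed.

Context d (T : measurableType d).
Variables (m1 m2 : {measure set T -> \bar R}) (x y : T -> n.-tuple R).
Hypotheses (mx : measurable_fun setT x) (my : measurable_fun setT y).
Hypothesis m1oo : m1 setT < +oo.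
Hypothesis m12 : forall B : 'I_n -> set R, (forall i, measurable (B i)) ->
    m1 (x @^-1` box B) = m2 (y @^-1` box B).

Let mfx : {mfun T >-> n.-tuple R} := HB.pack x (isMeasurableFun.Build _ _ _ _ _ mx).
Let mfy : {mfun T >-> n.-tuple R} := HB.pack y (isMeasurableFun.Build _ _ _ _ _ my).

Lemma tuple_law_unique (A : set (n.-tuple R)) : measurable A ->
  m1 (x @^-1` A) = m2 (y @^-1` A).
Proof.
move=> mA.
have := @tuple_measure_unique (pushforward m1 mfx) (pushforward m2 mfy).
by apply.
Qed.

Lemma tuple_integral_unique (f : n.-tuple R -> \bar R) :
  measurable_fun [set: n.-tuple R] f -> (forall v, 0 <= f v) ->
  \int[m1]_w f (x w) = \int[m2]_w f (y w).
Proof.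
move=> mf f0.
have := @ge0_integral_pushforward _ _ _ _ _ _ mx m1 setT f measurableT mf
  (fun v _ => f0 v).
rewrite preimage_setT => <-.
have := @ge0_integral_pushforward _ _ _ _ _ _ my m2 setT f measurableT mf
  (fun v _ => f0 v).
rewrite preimage_setT => <-.
apply: (@eq_measure_integral _ _ _ _ (pushforward m2 mfy)) => A mA _.
exact: tuple_law_unique.
Qed.

End tuple_laws.

(** * Increments over a grid: exchangeability and independence *)

Section measurable_walk.
Context {R : realType}.

Lemma measurable_running_min d (T : measurableType d) (f : T -> nat -> R) k :
  (forall i, measurable_fun setT (f ^~ i)) ->
  measurable_fun setT (fun w => running_min (f w) k).
Proof.
by move=> mf; elim: k => [|k IH] /=; [exact: mf|exact: measurable_minr].
Qed.

Lemma measurable_walk n k :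
  measurable_fun setT (fun x : n.-tuple R => walk x k).
Proof.
elim: k => [|k IH].
  by under eq_fun do rewrite walk0; exact: measurable_cst.
under eq_fun do rewrite walkS.
apply: measurable_funD => //; have [kn|nk] := ltnP k n.
  rewrite (_ : (fun x => _) = (fun x : n.-tuple R => tnth x (Ordinal kn))).
    exact: measurable_tnth.
  by apply/funext => x; rewrite (tnth_nth 0%R).
rewrite (_ : (fun x => _) = cst 0%R)//; apply/funext => x.
by rewrite nth_default// size_tuple.
Qed.

End measurable_walk.


Lemma integral_mrestr d (T : measurableType d) (R : realType)
    (m : {measure set T -> \bar R}) (E : set T) (mE : measurable E)
    (f : T -> \bar R) :
  measurable_fun setT f -> (forall w, 0 <= f w) ->
  \int[mrestr m mE]_w f w = \int[m]_(w in E) f w.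
Proof.
move=> mf f0; have mEC : measurable (~` E) by exact: measurableC.
rewrite -(setUv E) ge0_integral_setU//; last 2 first.
- exact: measurable_funTS.
- by apply/disj_setPS; rewrite setICr.
rewrite [X in _ + X]null_set_integral//; last 2 first.
- exact: measurable_funTS.
- by rewrite /= /mrestr setICl measure0.
rewrite adde0; apply: eq_measure_integral => A mA AE.
by rewrite /= /mrestr setIidl.
Qed.

Section increments.
Context d (T : measurableType d) (R : realType) (P : probability T R).
Variables (X : R -> {RV P >-> R}) (h : R).
Hypotheses (indep : independent_increments X) (stat : stationary_increments X).
Hypothesis h0 : (0 <= h)%R.

Let ti a i := ((a + i)%:R * h)%R.

Definition incs a n w : n.-tuple R :=
  [tuple increment X (ti a i) (ti a i.+1) w | i < n].

Lemma measurable_incs a n : measurable_fun setT (incs a n).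
Proof.
apply/measurable_fun_tnthP => i.
rewrite (_ : _ \o _ = increment X (ti a i) (ti a i.+1)); last first.
  by apply/funext => w /=; rewrite tnth_mktuple.
exact: measurable_funB.
Qed.

Lemma walk_incs a n k w : (k <= n)%N ->
  walk (incs a n w) k = (X ((a + k)%:R * h)%R w - X (a%:R * h)%R w)%R.
Proof.
elim: k => [_|k IH kn]; first by rewrite walk0 addn0 subrr.
rewrite walkS IH ?(ltnW kn)//.
rewrite (_ : (incs a n w)`_k = increment X (ti a k) (ti a k.+1) w).
  by rewrite /increment /ti; lra.
by rewrite -(tnth_nth 0%R (incs a n w) (Ordinal kn)) tnth_mktuple.
Qed.

Lemma prob_box_incs a n (B : 'I_n -> set R) : (forall i, measurable (B i)) ->
  P (incs a n @^-1` box B) = \prod_(i < n) P (X h @^-1` B i).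
Proof.
move=> mB.
pose B' k := if insub k is Some i then B i else setT.
have B'E (i : 'I_n) : B' i = B i.
  by rewrite /B'; case: insubP => [j _ /ord_inj ->//|]; rewrite ltn_ord.
rewrite (_ : _ @^-1` _ = \bigcap_(i in `I_n)
    (increment X (ti a i) (ti a i.+1) @^-1` B' i)); last first.
  apply/seteqP; split => w /= Bw i.
    move=> /= i_n; have := Bw (Ordinal i_n).
    by rewrite tnth_mktuple -B'E.
  by rewrite tnth_mktuple -B'E; exact: (Bw i (ltn_ord i)).
rewrite indep; last 3 first.
- by rewrite mulr_ge0.
- by move=> i j ij; rewrite ler_wpM2r// ler_nat leq_add2l.
- by move=> i; rewrite /B'; case: insubP => //= j _ _; exact: mB.
apply: eq_bigr => i _; rewrite B'E stat//.
- by rewrite /ti (_ : _ - _ = h)%R// addnS -natr1; lra.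
- by rewrite mulr_ge0.
- by rewrite ler_wpM2r// ler_nat leq_add2l.
Qed.

(** The probability of a box is a product of [n] probabilities under one and the
    same law, hence it depends neither on the starting point [a] nor on the
    order of the sides. *)
Lemma integral_perm_incs a n (s : {perm 'I_n}) (f : n.-tuple R -> \bar R) :
  measurable_fun setT f -> (forall v, 0 <= f v) ->
  \int[P]_w f (incs a n w) =
  \int[P]_w f [tuple tnth (incs 0 n w) (s i) | i < n].
Proof.
move=> mf f0; apply: (@tuple_integral_unique _ _ _ _ P P (incs a n)
  (fun w => [tuple tnth (incs 0 n w) (s i) | i < n])) => //.
- exact: measurable_incs.
- apply/measurable_fun_tnthP => i.
  have /measurable_fun_tnthP /(_ (s i)) := @measurable_incs 0 n.
  by apply: eq_measurable_fun => w _ /=; rewrite !tnth_mktuple.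
- by rewrite (le_lt_trans (probability_le1 P measurableT))// ltry.
move=> B mB; transitivity (P (incs a n @^-1` box B)) => //.
rewrite prob_box_incs//.
transitivity (P (incs 0 n @^-1` box (fun i => B ((s^-1)%g i)))).
  rewrite prob_box_incs => [|i]; last exact: mB.
  rewrite [RHS](reindex_perm s)/=; apply: eq_bigr => i _.
  by rewrite permK.
congr (P _); apply/seteqP; split => w /= Bw i.
  by have := Bw (s i); rewrite permK tnth_mktuple.
by have := Bw ((s^-1)%g i); rewrite tnth_mktuple permKV.
Qed.

Lemma prob_box_incs2 n m (B : 'I_n -> set R) (C : 'I_m -> set R) :
  (forall i, measurable (B i)) -> (forall i, measurable (C i)) ->
  P (incs 0 n @^-1` box B `&` incs n m @^-1` box C) =
  P (incs 0 n @^-1` box B) * P (incs 0 m @^-1` box C).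
Proof.
move=> mB mC; rewrite !prob_box_incs//.
pose D i := match fintype.split i with inl j => B j | inr j => C j end.
have mD i : measurable (D i) by rewrite /D; case: (fintype.split i).
transitivity (P (incs 0 (n + m) @^-1` box D)); last first.
  rewrite prob_box_incs// big_split_ord/=; congr (_ * _).
    by apply: eq_bigr => i _; rewrite /D (unsplitK (inl i)).
  by apply: eq_bigr => i _; rewrite /D (unsplitK (inr i)).
congr (P _); apply/seteqP; split => w /=.
  move=> [Bw Cw] i; rewrite /D; case: fintype.splitP => j ij.
    by have := Bw j; rewrite !tnth_mktuple ij.
  by have := Cw j; rewrite !tnth_mktuple ij/= /ti !add0n !addnS.
move=> Dw; split => j.
  by have := Dw (lshift m j); rewrite /D (unsplitK (inl j)) !tnth_mktuple.
have := Dw (rshift n j).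
by rewrite /D (unsplitK (inr j)) !tnth_mktuple/= /ti !add0n !addnS.
Qed.

Let mpre a n (A : set (n.-tuple R)) : measurable A ->
  measurable (incs a n @^-1` A).
Proof. by move=> mA; rewrite -[X in measurable X]setTI; exact: measurable_incs. Qed.


Let restr_prob n (E : set T) (mE : measurable E) :
  (forall B : 'I_n -> set R, (forall i, measurable (B i)) ->
    P (incs 0 n @^-1` box B `&` E) = P (incs 0 n @^-1` box B) * P E) ->
  forall f : n.-tuple R -> \bar R,
  measurable_fun setT f -> (forall v, 0 <= f v) ->
  \int[P]_(w in E) f (incs 0 n w) = P E * \int[P]_w f (incs 0 n w).
Proof.
move=> BE f mf f0.
have PEfin : P E \is a fin_num by exact: fin_num_measure.
have PE0 : (0 <= fine (P E))%R by rewrite fine_ge0.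
have mfi : measurable_fun setT (fun w => f (incs 0 n w)).
  by apply: measurableT_comp => //; exact: measurable_incs.
rewrite -(integral_mrestr _ mE)//.
transitivity (\int[mscale (NngNum PE0) P]_w f (incs 0 n w)); last first.
  by rewrite ge0_integral_mscale//= fineK.
apply: tuple_integral_unique => //.
- exact: measurable_incs.
- exact: measurable_incs.
- rewrite /= /mrestr setTI (le_lt_trans (probability_le1 _ _))// ltry//.
- move=> B mB; rewrite /= /mrestr /mscale/= fineK// BE//.
  by rewrite muleC.
Qed.

(** Independence passes from boxes to measurable sets one factor at a time: a
    fixed box for the past first, then a fixed measurable set for the future. *)
Lemma prob_incs_indep_box n m (B : 'I_n -> set R) (C : set (m.-tuple R)) :
  (forall i, measurable (B i)) -> measurable C ->
  P (incs 0 n @^-1` box B `&` incs n m @^-1` C) =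
  P (incs 0 n @^-1` box B) * P (incs 0 m @^-1` C).
Proof.
move=> mB mC; set D := incs 0 n @^-1` box B.
have mD : measurable D by apply: mpre; exact: measurable_box.
have PDfin : P D \is a fin_num by exact: fin_num_measure.
have PD0 : (0 <= fine (P D))%R by rewrite fine_ge0.
transitivity (mrestr P mD (incs n m @^-1` C)).
  by rewrite /mrestr setIC.
rewrite -[P D]fineK// -[_ * _]/(mscale (NngNum PD0) P (incs 0 m @^-1` C)).
apply: tuple_law_unique => //.
- exact: measurable_incs.
- exact: measurable_incs.
- by rewrite /= /mrestr setTI (le_lt_trans (probability_le1 _ _))// ltry.
- move=> G mG; rewrite /= /mrestr /mscale/= fineK// setIC.
  exact: prob_box_incs2.
Qed.

Lemma integral_incs_indep n m (C : set (m.-tuple R)) (f : n.-tuple R -> \bar R) :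
  measurable C -> measurable_fun setT f -> (forall v, 0 <= f v) ->
  \int[P]_(w in incs n m @^-1` C) f (incs 0 n w) =
  P (incs 0 m @^-1` C) * \int[P]_w f (incs 0 n w).
Proof.
move=> mC mf f0.
have PC : P (incs n m @^-1` C) = P (incs 0 m @^-1` C).
  have := @prob_incs_indep_box n m (fun=> setT) C.
  have -> : incs 0 n @^-1` box (fun=> setT) = setT by apply/seteqP; split.
  by rewrite setTI probability_setT mul1e; apply.
rewrite -PC; apply: restr_prob => //; first exact: mpre.
by move=> B mB; rewrite prob_incs_indep_box// PC.
Qed.

Lemma prob_incs_indep n m (A : set (n.-tuple R)) (C : set (m.-tuple R)) :
  measurable A -> measurable C ->
  P (incs 0 n @^-1` A `&` incs n m @^-1` C) =
  P (incs 0 n @^-1` A) * P (incs 0 m @^-1` C).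
Proof.
move=> mA mC.
have := @integral_incs_indep n m C (fun v => (\1_A v)%:E) mC.
have -> : \int[P]_w (\1_A (incs 0 n w))%:E = P (incs 0 n @^-1` A).
  transitivity (\int[P]_w (\1_(incs 0 n @^-1` A) w)%:E) => //.
  by rewrite integral_indic ?setIT//; exact: mpre.
have -> : \int[P]_(w in incs n m @^-1` C) (\1_A (incs 0 n w))%:E =
    P (incs 0 n @^-1` A `&` incs n m @^-1` C).
  transitivity (\int[P]_(w in incs n m @^-1` C)
    (\1_(incs 0 n @^-1` A) w)%:E) => //.
  by rewrite integral_indic//; exact: mpre.
rewrite muleC; apply.
- by apply/measurable_EFinP; exact: measurable_indic.
- by move=> v; rewrite lee_fin.
Qed.

End increments.

(** * The process sampled on a grid *)

Lemma sum_const_ereal (R : realType) n (c : \bar R) :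
  \sum_(i < n) c = n%:R%:E * c.
Proof.
elim: n => [|n IH]; first by rewrite big_ord0 mul0e.
by rewrite big_ord_recr/= IH -natr1 EFinD ge0_muleDl ?mul1e ?lee_fin.
Qed.

Section measurable_comparison.
Context d (T : measurableType d) (R : realType).
Implicit Types f g : T -> R.

Lemma measurable_set_lt f g : measurable_fun setT f -> measurable_fun setT g ->
  measurable [set w | (f w < g w)%R].
Proof.
move=> mf mg; rewrite -[X in measurable X]setTI.
exact: (measurable_fun_ltr mf mg measurableT (Y := [set true])).
Qed.

Lemma measurable_set_le f g : measurable_fun setT f -> measurable_fun setT g ->
  measurable [set w | (f w <= g w)%R].
Proof.
move=> mf mg; rewrite -[X in measurable X]setTI.
exact: (measurable_fun_ler mf mg measurableT (Y := [set true])).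
Qed.

End measurable_comparison.

Section random_walk.
Context d (T : measurableType d) (R : realType) (P : probability T R).
Variables (Z : R -> {RV P >-> R}) (h : R).
Hypotheses (indep : independent_increments Z) (stat : stationary_increments Z).
Hypotheses (Z0 : forall w, Z 0%R w = 0%R) (h0 : (0 <= h)%R).

Definition sample k w : R := Z (k%:R * h)%R w.
Definition low k w : R := running_min (fun i => sample i w) k.
Definition new_low k w : R := (low k w - low k.+1 w)%R.

Lemma sample0 w : sample 0 w = 0%R. Proof. by rewrite /sample mul0r Z0. Qed.

Lemma measurable_sample k : measurable_fun setT (sample k).
Proof. exact: measurable_funPT. Qed.

Lemma measurable_low k : measurable_fun setT (low k).
Proof. by apply: measurable_running_min => i; exact: measurable_sample. Qed.

Lemma new_low_ge0 k w : (0 <= new_low k w)%R.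
Proof. by rewrite subr_ge0 running_minS_le. Qed.

Lemma measurable_new_low k : measurable_fun setT (new_low k).
Proof. by apply: measurable_funB; exact: measurable_low. Qed.

Lemma walk_sample n k w : (k <= n)%N -> walk (incs Z h 0 n w) k = sample k w.
Proof. by move=> kn; rewrite walk_incs// add0n -/(sample k w) -/(sample 0 w) sample0 subr0. Qed.

Lemma walk_shift_sample a n k w : (k <= n)%N ->
  walk (incs Z h a n w) k = (sample (a + k) w - sample a w)%R.
Proof. by move=> kn; rewrite walk_incs. Qed.

Lemma low_walk n k w : (k <= n)%N ->
  running_min (walk (incs Z h 0 n w)) k = low k w.
Proof.
move=> kn; apply: eq_running_min => i ik.
by rewrite walk_sample// (leq_trans ik).
Qed.

Let new_low_fun n (x : n.+1.-tuple R) : R :=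
  Num.max 0%R (running_min (walk x) n - walk x n.+1)%R.

Let measurable_new_low_fun n : measurable_fun setT (@new_low_fun n).
Proof.
apply: measurable_maxr; first exact: measurable_cst.
apply: measurable_funB; last exact: measurable_walk.
by apply: measurable_running_min => i; exact: measurable_walk.
Qed.

Let new_low_fun_ge0 n (x : n.+1.-tuple R) : (0 <= new_low_fun x)%R.
Proof. by rewrite /new_low_fun le_max lexx. Qed.

Let new_low_funE n w : new_low_fun (incs Z h 0 n.+1 w) = new_low n w.
Proof.
rewrite /new_low_fun low_walk// walk_sample// /new_low -[low n.+1 w]/(running_min _ n.+1).
by rewrite running_min_drop.
Qed.

(** The [n.+1] rotations of the increments all have the same law, and over them
    the new lows add up to the negative part of the endpoint. *)
Lemma expected_new_low n :
  n.+1%:R%:E * \int[P]_w (new_low n w)%:E = \int[P]_w (Num.max 0 (- sample n.+1 w))%:E.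
Proof.
pose rot (j : nat) (x : n.+1.-tuple R) :=
  [tuple tnth x (rot_perm n j i) | i < n.+1].
have mrot j : measurable_fun setT (rot j).
  apply/measurable_fun_tnthP => i.
  rewrite (_ : _ \o _ = fun x : n.+1.-tuple R => tnth x (rot_perm n j i)).
    exact: measurable_tnth.
  by apply/funext => x /=; rewrite tnth_mktuple.
have mi := @measurable_incs _ _ _ _ Z h 0 n.+1.
transitivity (\sum_(j < n.+1) \int[P]_w (new_low_fun (rot j (incs Z h 0 n.+1 w)))%:E).
  under eq_bigr => j _.
    rewrite -(@integral_perm_incs _ _ _ _ _ _ indep stat h0 0 _ (rot_perm n j)
      (fun x => (new_low_fun x)%:E)); last 2 first.
    - by apply/measurable_EFinP; exact: measurable_new_low_fun.
    - by move=> v; rewrite lee_fin.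
    under eq_integral do rewrite new_low_funE.
    over.
  by rewrite sum_const_ereal.
rewrite -ge0_integral_sum//.
- apply: eq_integral => w _; rewrite sumEFin.
  by rewrite sum_rot_drop walk_sample.
- move=> j; apply/measurable_EFinP; apply: (measurableT_comp (@measurable_new_low_fun n)).
  exact: (measurableT_comp (mrot j) mi).
- by move=> j w _; rewrite lee_fin.
Qed.

Lemma expected_new_low_future n m :
  \int[P]_(w in [set w | (sample n.+1 w < sample (n.+1 + m) w)%R]) (new_low n w)%:E =
  P [set w | (0 < sample m w)%R] * \int[P]_w (new_low n w)%:E.
Proof.
pose C := [set v : m.-tuple R | (0 < walk v m)%R].
have mC : measurable C by apply: measurable_set_lt => //; exact: measurable_walk.
have := @integral_incs_indep _ _ _ P Z h indep stat h0 n.+1 m C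
  (fun x => (new_low_fun x)%:E) mC.
rewrite (_ : incs Z h n.+1 m @^-1` C = [set w | (sample n.+1 w < sample (n.+1 + m) w)%R]).
  rewrite (_ : incs Z h 0 m @^-1` C = [set w | (0 < sample m w)%R]).
    have E D : \int[P]_(w in D) (new_low n w)%:E =
        \int[P]_(w in D) (new_low_fun (incs Z h 0 n.+1 w))%:E.
      by apply: eq_integral => w _; rewrite new_low_funE.
    rewrite !E; apply; last by move=> v; rewrite lee_fin.
    by apply/measurable_EFinP; exact: measurable_new_low_fun.
  by apply/seteqP; split => w /=; rewrite /C/= walk_sample.
by apply/seteqP; split => w /=; rewrite /C/= walk_shift_sample// subr_gt0.
Qed.

(** Reversing the order of the increments turns the partial sum at [k] into the
    endpoint minus the partial sum at [n - k], hence the maximum into the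
    endpoint minus the minimum. *)
Lemma expected_max_min n :
  \int[P]_w (- running_min (fun i => - sample i w)%R n)%:E =
  \int[P]_w (sample n w - low n w)%:E.
Proof.
pose rev_tuple (x : n.-tuple R) := [tuple tnth x (perm rev_ord_inj i) | i < n].
have walk_rev x k : (k <= n)%N ->
    walk (rev_tuple x) k = (walk x n - walk x (n - k))%R.
  elim: k => [_|k IH kn]; first by rewrite walk0 subn0 subrr.
  rewrite walkS IH ?(ltnW kn)//.
  have -> : (rev_tuple x)`_k = x`_(n - k.+1).
    transitivity (tnth (rev_tuple x) (Ordinal kn)); first by rewrite (tnth_nth 0%R).
    by rewrite tnth_mktuple permE (tnth_nth 0%R).
  by rewrite -[in LHS](subnSK kn) walkS; lra.
pose f (x : n.-tuple R) := (- running_min (fun i => - walk x i)%R n)%R.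
have f_rev x : f (rev_tuple x) = (walk x n - running_min (walk x) n)%R.
  apply/le_anti/andP; split.
    have [i i_n] := running_minP (fun i => - walk (rev_tuple x) i)%R n.
    rewrite /f => ->; rewrite opprK walk_rev// lerD2l lerN2.
    by apply: running_min_le; exact: leq_subr.
  have [i i_n ->] := running_minP (walk x) n.
  have := running_min_le (fun i => - walk (rev_tuple x) i)%R (leq_subr i n).
  by rewrite /f walk_rev ?leq_subr// subKn//; lra.
transitivity (\int[P]_w (f (incs Z h 0 n w))%:E).
  apply: eq_integral => w _; congr (- _)%:E; apply: eq_running_min => i i_n.
  by rewrite walk_sample.
transitivity (\int[P]_w (f (rev_tuple (incs Z h 0 n w)))%:E); last first.
  by apply: eq_integral => w _; rewrite f_rev walk_sample// low_walk.
apply: (integral_perm_incs indep stat h0 0 (perm rev_ord_inj)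
  (f := fun x => (f x)%:E)) => [|v].
  apply/measurable_EFinP; apply: measurableT_comp => //.
  apply: measurable_running_min => i; apply: measurableT_comp => //.
  exact: measurable_walk.
rewrite lee_fin oppr_ge0.
by have := running_min_le (fun i => - walk v i)%R (leq0n n); rewrite walk0 oppr0.
Qed.

Lemma low_le0 n w : (low n w <= 0)%R.
Proof. by have := running_min_le (fun i => sample i w) (leq0n n); rewrite sample0. Qed.

Let first_passage a k := [set w | (- a <= low k w)%R] `&` [set w | (low k.+1 w < - a)%R].

Let measurable_first_passage a k : measurable (first_passage a k).
Proof.
apply: measurableI.
  by apply: measurable_set_le => //; exact: measurable_low.
by apply: measurable_set_lt => //; exact: measurable_low.
Qed.

Let sum_first_passage a n : (0 <= a)%R ->
  \sum_(k < n) P (first_passage a k) = P [set w | (low n w < - a)%R].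
Proof.
move=> a0; elim: n => [|n IH].
  rewrite big_ord0 (_ : [set w | _] = set0) ?measure0//.
  by apply/seteqP; split => // w /=; rewrite /low/= sample0; lra.
rewrite big_ord_recr/= IH -measureU//; last 2 first.
- by apply: measurable_set_lt => //; exact: measurable_low.
- apply/seteqP; split => // w /= [h1 [h2 _]].
  by move: h1 h2 => /=; rewrite leNgt => ->.
congr (P _); apply/seteqP; split => w /=.
  move=> [|[]//]; have := running_minS_le (fun i => sample i w) n.
  by rewrite -/(low n w) -/(low n.+1 w); lra.
by rewrite /first_passage/= => ?; have [?|?] := ltP (low n w) (- a)%R; [left|right].
Qed.

(** At its first passage below [- a] a path with small falls is still above
    [- (a + e)], so that it has to fall by more than [b] after that time in order
    to get below [- (a + b + e)].  The fall after a given time is independent of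
    the past and at most as deep, in law, as the fall over the whole grid. *)
Lemma tail_submultiplicative n a b e : (0 <= a)%R -> (0 <= b)%R -> (0 <= e)%R ->
  P ([set w | (low n w < - (a + b + e))%R] `&`
     [set w | forall k, (k < n)%N -> (sample k w - e <= sample k.+1 w)%R]) <=
  P [set w | (low n w < - a)%R] * P [set w | (low n w < - b)%R].
Proof.
move=> a0 b0 e0.
pose C m := [set v : m.-tuple R | (running_min (walk v) m < - b)%R].
have mC m : measurable (C m).
  apply: measurable_set_lt => //; apply: measurable_running_min => i.
  exact: measurable_walk.
have mCi q m : measurable (incs Z h q m @^-1` C m).
  by rewrite -[X in measurable X]setTI; apply: measurable_incs => //; exact: mC.
pose G k := first_passage a k `&` incs Z h k.+1 (n - k.+1) @^-1` C (n - k.+1)%N.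
have mG k : measurable (G k).
  by apply: measurableI; [exact: measurable_first_passage|exact: mCi].
apply: (@le_trans _ _ (\sum_(k < n) P (G k))).
  apply: (@content_subadditive _ _ _ P _ G) => //.
    apply: measurableI; first by apply: measurable_set_lt => //; exact: measurable_low.
    rewrite (_ : [set w | _] = \bigcap_(k in `I_n) [set w | (sample k w - e <= sample k.+1 w)%R]).
      apply: bigcap_measurableType => k _; apply: measurable_set_le => //.
      exact: measurable_funB.
    by apply/seteqP; split.
  rewrite -bigcup_mkord => w [/= Jn gap].
  have ex : exists k, (low k w < - a)%R by exists n; lra.
  case: (ex_minnP ex) => -[|k] Jk kmin; first by move: Jk; rewrite /low/= sample0; lra.
  have kn : (k < n)%N by apply: kmin; lra.
  have Jk' : (- a <= low k w)%R by rewrite leNgt; apply/negP => /kmin; rewrite ltnn.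
  exists k => //; split=> //; rewrite /C/=.
  have [i i_n JS] := running_minP (fun i => sample i w) n.
  have ki : (k < i)%N.
    rewrite ltnNge; apply/negP => /(running_min_le (fun i => sample i w)).
    by rewrite -JS -/(low k w) -/(low n w); lra.
  have := running_min_le (walk (incs Z h k.+1 (n - k.+1) w))
    (leq_sub2r k.+1 i_n).
  rewrite walk_shift_sample ?leq_sub2r// subnKC// -JS -/(low n w).
  have := gap _ kn; have := running_min_le (fun i => sample i w) (leqnn k).
  by rewrite -/(low k w); lra.
rewrite -sum_first_passage// ge0_sume_distrl//.
apply: lee_sum => k _; rewrite /G.
have -> : first_passage a k =
    incs Z h 0 k.+1 @^-1` [set v | (- a <= running_min (walk v) k)%R /\
                                  (running_min (walk v) k.+1 < - a)%R].
  by apply/funext => w; rewrite /preimage /first_passage /setI /mkset !low_walk.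
rewrite prob_incs_indep//; last first.
  apply: measurableI.
    apply: measurable_set_le => //; apply: measurable_running_min => i.
    exact: measurable_walk.
  apply: measurable_set_lt => //; apply: measurable_running_min => i.
  exact: measurable_walk.
apply: lee_wpmul2l => //; apply: le_measure; rewrite ?inE//.
  by apply: measurable_set_lt => //; exact: measurable_low.
move=> w /=; rewrite /C/= low_walk//; apply: le_lt_trans.
by rewrite /low; apply: running_min_homo; exact: leq_subr.
Qed.

End random_walk.

(** * Cadlag paths *)

Section cadlag_paths.
Context {R : realType}.
Implicit Types f : R -> R.
Local Close Scope ereal_scope.

Lemma cadlag_right f (s e : R) : cadlag f -> 0 <= s -> 0 < e ->
  exists2 r, 0 < r & forall x, s <= x < s + r -> `|f x - f s| < e.
Proof.
move=> [cf _] s0 e0.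
have /cvgrPdist_lt /(_ _ e0) := cf _ s0.
rewrite near_withinE near_simpl => /nbhs_ballP[r/= r0 fr].
exists r => // x /andP[]; rewrite le_eqVlt => /predU1P[<- _|sx xr].
  by rewrite subrr normr0.
rewrite distrC; apply: fr => //=.
by rewrite /ball/= ltr0_norm ?subr_lt0//; lra.
Qed.

Lemma cadlag_left f (s e : R) : cadlag f -> 0 < s -> 0 < e ->
  exists2 r, 0 < r & forall x, s - r < x < s ->
    `|f x - lim (f y @[y --> s^'-])| < e.
Proof.
move=> [_ cf] s0 e0.
have /cvgrPdist_lt /(_ _ e0) := cf _ s0.
rewrite near_withinE near_simpl => /nbhs_ballP[r/= r0 fr].
exists r => // x /andP[rx xs].
rewrite distrC; apply: fr => //=.
by rewrite /ball/= gtr0_norm ?subr_gt0//; lra.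
Qed.

(** Near each point a cadlag path stays close to its value there or to its left
    limit; compactness of [[0, t]] makes the local bounds uniform. *)
Lemma cadlag_bounded f (t : R) : cadlag f ->
  exists M, forall s, 0 <= s <= t -> `|f s| <= M.
Proof.
move=> cf.
have /compact_near_coveringP /near_covering_withinP K := @segment_compact _ 0 t.
have := K R (pinfty_nbhs R) (fun M x => `|f x| <= M) _.
have h (x : R) : `[0, t]%classic x ->
    \forall x' \near x & M \near +oo, `[0, t]%classic x' -> `|f x'| <= M.
  move=> /=; rewrite in_itv/= => /andP[x0 _].
  have [r r0 fr] := cadlag_right cf x0 (@ltr01 R).
  have [q q0 fq] : exists2 q, 0 < q & exists C, forall y,
      0 <= y -> x - q < y < x -> `|f y| <= C.
    move: x0; rewrite le_eqVlt => /predU1P[<-|x0].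
      by exists 1 => //; exists 0 => y ? /andP[_ ?]; lra.
    have [q q0 fq] := cadlag_left cf x0 (@ltr01 R).
    exists q => //; exists (`|lim (f y @[y --> x^'-])| + 1) => y _ /fq h.
    by have := ler_distD 0 (f y) (lim (f y @[y --> x^'-]));
       rewrite !subr0; have := ler_normD (f y - lim (f y @[y --> x^'-]))
        (lim (f y @[y --> x^'-])); rewrite subrK; lra.
  case: fq => C fq.
  near=> x' M => /=; rewrite in_itv/= => /andP[x'0 x't].
  have xx' : `|x - x'| < Num.min r q.
    by near: x'; exists (Num.min r q) => //=; rewrite lt_min r0.
  move: xx'; rewrite lt_min !ltr_norml => /andP[/andP[? ?] /andP[? ?]].
  have [x'x|xx'] := ltP x' x.
    apply: (@le_trans _ _ C).
      by apply: fq => //; apply/andP; split => //; lra.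
    by near: M; apply: nbhs_pinfty_ge; exact: num_real.
  apply: (@le_trans _ _ (`|f x| + 1)).
    have := fr x'; rewrite xx'/= => /(_ ltac:(lra)).
    by have := ler_normD (f x' - f x) (f x); rewrite subrK; lra.
  by near: M; apply: nbhs_pinfty_ge; exact: num_real.
move=> /(_ _ h) /filter_ex[M KM'].
by exists M => s st; apply: KM'; rewrite /= in_itv.
Unshelve. all: by end_near. Qed.

(** Around a point [s] the path is close to its left limit before [s] and to
    [f s] after it, and [f s] is not the smaller of the two: near [s] the path
    cannot fall by [e].  Compactness of [[0, t]] gives a uniform scale [q]. *)
Lemma cadlag_no_negative_jump f (t e : R) : cadlag f ->
  (forall s, 0 < s -> 0 <= jump f s) -> 0 < e ->
  exists2 q, 0 < q & forall u v, 0 <= u -> u <= v -> v <= t -> v - u < q ->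
    f u - e <= f v.
Proof.
move=> cf jf e0.
have /compact_near_coveringP /near_covering_withinP K := @segment_compact _ 0 t.
have := K R (0^'+) (fun q u => forall v, u <= v -> v - u < q -> f u - e <= f v) _.
have h (x : R) : `[0, t]%classic x ->
    \forall x' \near x & M \near 0^'+, `[0, t]%classic x' ->
     forall v, x' <= v -> v - x' < M -> f x' - e <= f v.
  move=> /=; rewrite in_itv/= => /andP[x0 _].
  have e20 : 0 < e / 2 by lra.
  have [r r0 fr] := cadlag_right cf x0 e20.
  have [q q0 fq] : exists2 q, 0 < q & forall y,
      0 <= y -> x - q < y < x -> f y - e <= f x - e / 2 /\
       forall z, y <= z < x -> f y - e <= f z.
    move: x0; rewrite le_eqVlt => /predU1P[<-|x0].
      by exists 1 => // y ? /andP[_ ?]; lra.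
    have [q q0 fq] := cadlag_left cf x0 e20.
    exists q => // y y0 yx; have := fq _ yx; rewrite ltr_norml => /andP[? ?].
    have := jf _ x0; rewrite /jump => ?.
    split; first by lra.
    move=> z /andP[yz zx]; have := fq z; rewrite ltr_norml.
    by move: yx => /andP[? ?]; case/(_ ltac:(lra))/andP => ? ?; lra.
  near=> x' M => /=; rewrite in_itv/= => /andP[x'0 x't] v x'v vM.
  have xx' : `|x - x'| < Num.min (r / 2) q.
    near: x'; exists (Num.min (r / 2) q) => //=.
    by rewrite lt_min q0 andbT divr_gt0.
  have Mr : M < r / 2 by near: M; apply: nbhs_right_lt; rewrite divr_gt0.
  move: xx'; rewrite lt_min !ltr_norml => /andP[/andP[? ?] /andP[? ?]].
  have [x'x|xx'] := ltP x' x; last first.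
    have := fr x'; rewrite ltr_norml => /(_ ltac:(lra))/andP[? ?].
    by have := fr v; rewrite ltr_norml => /(_ ltac:(lra))/andP[? ?]; lra.
  have [|fx' fz] := fq x' x'0; first by apply/andP; split => //; lra.
  have [vx|xv] := ltP v x; first by apply: fz; rewrite x'v.
  by have := fr v; rewrite ltr_norml => /(_ ltac:(lra))/andP[? ?]; lra.
move=> /(_ _ h) KM.
have [q q0 KM'] : exists2 q, 0 < q & `[0, t]%classic `<=`
    (fun u => forall v, u <= v -> v - u < q -> f u - e <= f v).
  by near (0:R)^'+ => q; exists q => //; near: q.
exists q => // u v u0 uv vt; apply: KM' => //.
by rewrite /= in_itv/= u0 (le_trans uv vt).
Unshelve. all: by end_near. Qed.

End cadlag_paths.

(** * Dyadic grids *)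

Section dyadic_grid.
Context {R : realType}.
Variable t : R.
Hypothesis t0 : (0 < t)%R.
Implicit Types (f : R -> R) (s : R).
Local Close Scope ereal_scope.

Definition mesh n : R := t / 2 ^+ n.

Lemma mesh_gt0 n : 0 < mesh n.
Proof. by rewrite divr_gt0// exprn_gt0. Qed.

Lemma mesh_last n : (2 ^ n)%:R * mesh n = t.
Proof. by rewrite /mesh natrX mulrCA divff ?mulr1// expf_neq0. Qed.

Lemma mesh_half n : mesh n = 2 * mesh n.+1.
Proof.
have : (2 ^+ n : R) != 0 by rewrite expf_neq0.
by rewrite /mesh exprS => ?; field.
Qed.

Lemma cvg_mesh : mesh n @[n --> \oo] --> 0.
Proof.
rewrite (_ : mesh = (fun n => t * 2^-1 ^+ n)); last first.
  by apply/funext => n; rewrite /mesh exprVn.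
apply: cvg_geometric.
by rewrite ger0_norm ?invr_ge0// invf_lt1// ltr1n.
Qed.

Lemma grid_in n k : (k <= 2 ^ n)%N -> 0 <= k%:R * mesh n <= t.
Proof.
move=> kn; rewrite mulr_ge0 ?(ltW (mesh_gt0 n))//= -[leRHS](mesh_last n).
by rewrite ler_wpM2r ?(ltW (mesh_gt0 n))// ler_nat.
Qed.

(** The first index strictly after [s]: approaching [s] from the right is what
    makes the values of a cadlag path converge. *)
Definition next_index n s : nat := (Num.truncn (s / mesh n)).+1.

Lemma next_index_itv n s : 0 <= s -> s < (next_index n s)%:R * mesh n <= s + mesh n.
Proof.
move=> s0; have m0 := mesh_gt0 n.
have /truncn_itv/andP[h1 h2] : 0 <= s / mesh n by rewrite divr_ge0// ltW.
rewrite -ltr_pdivrMr// h2/= /next_index -natr1 mulrDl mul1r lerD2r.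
by rewrite -ler_pdivlMr.
Qed.

Lemma next_index_le n s : 0 <= s < t -> (next_index n s <= 2 ^ n)%N.
Proof.
move=> /andP[s0 st]; have sm0 : 0 <= s / mesh n by rewrite divr_ge0// ltW// mesh_gt0.
by rewrite /next_index truncn_lt_nat// ltr_pdivrMr ?mesh_gt0// mesh_last.
Qed.

Lemma cvg_next_index s : 0 <= s -> (next_index n s)%:R * mesh n @[n --> \oo] --> s.
Proof.
move=> s0; apply: (@squeeze_cvgr _ _ _ _ (cst s) (fun n => s + mesh n)).
- by near=> n; have /andP[/ltW -> ->] := next_index_itv n s0.
- exact: cvg_cst.
- by rewrite -[X in _ --> X]addr0; apply: cvgD; [exact: cvg_cst|exact: cvg_mesh].
Unshelve. all: by end_near. Qed.

Lemma cvg_path_next_index f s : cadlag f -> 0 <= s ->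
  f ((next_index n s)%:R * mesh n) @[n --> \oo] --> f s.
Proof.
move=> [cf _] s0; have /cvg_at_rightP := cf _ s0; apply; split.
  by move=> n; have /andP[] := next_index_itv n s0.
exact: cvg_next_index.
Qed.

Definition grid_min f n : R := running_min (fun k => f (k%:R * mesh n)) (2 ^ n).

Lemma grid_min_le f n k : (k <= 2 ^ n)%N -> grid_min f n <= f (k%:R * mesh n).
Proof. exact: (running_min_le (fun k => f (k%:R * mesh n))). Qed.

Lemma grid_min_nonincreasing f : {homo grid_min f : m n / (m <= n)%N >-> n <= m}.
Proof.
apply: homo_leq => [//|y x z /[swap]|n]; first exact: le_trans.
have [i i_n] := running_minP (fun k => f (k%:R * mesh n)) (2 ^ n).
rewrite [leRHS]/grid_min => ->; rewrite mesh_half mulrA -natrM; apply: grid_min_le.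
by rewrite expnS mulnC leq_mul2l.
Qed.

Lemma cvg_grid_min f : cadlag f ->
  (- grid_min f n)%:E @[n --> \oo] -->
  ereal_sup [set (- f s)%:E | s in `[0, t]%classic].
Proof.
move=> cf; rewrite [X in _ --> X](_ : _ =
    ereal_sup (range (fun n => (- grid_min f n)%:E))).
  apply: ereal_nondecreasing_cvgn => m n mn.
  by rewrite lee_fin lerN2 grid_min_nonincreasing.
apply/eqP; rewrite eq_le; apply/andP; split.
- apply: ge_ereal_sup => _ /= [s + <-]; rewrite in_itv/= => /andP[s0 st].
  have le k n : (k <= 2 ^ n)%N -> ((- f (k%:R * mesh n))%:E <=
      ereal_sup (range (fun n => (- grid_min f n)%:E)))%E.
    move=> kn; apply: (@le_trans _ _ (- grid_min f n)%:E).
      by rewrite lee_fin lerN2 grid_min_le.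
    by apply: ereal_sup_ubound; exists n.
  have [ts|ts] := leP t s.
    by rewrite (_ : s = (2 ^ 0)%:R * mesh 0) ?le// mesh_last; apply/le_anti/andP.
  have fs : (- f ((next_index n s)%:R * mesh n))%:E @[n --> \oo] --> (- f s)%:E.
    apply: cvg_EFin; first by near=> n.
    by apply: cvgN; exact: cvg_path_next_index.
  apply: (cvge_le _ fs).
  by near=> n; apply: le; apply: next_index_le; rewrite s0 ts.
- apply: ge_ereal_sup => _ [n _ <-]; apply: ereal_sup_ubound => /=.
  have [i i_n] := running_minP (fun k => f (k%:R * mesh n)) (2 ^ n).
  rewrite /grid_min => ->; exists (i%:R * mesh n) => //=.
  by rewrite in_itv/=; exact: grid_in.
Unshelve. all: by end_near. Qed.

End dyadic_grid.

(** * The depth of a spectrally positive process *)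

Section drawdown.
Context d (T : measurableType d) (R : realType) (P : probability T R).
Variable (Z : R -> {RV P >-> R}).
Hypotheses (levyZ : levy_process Z) (posZ : spectrally_positive Z).
Hypothesis Z0 : forall w, Z 0%R w = 0%R.

Definition depth t w : \bar R :=
  ereal_sup [set (- Z s w)%:E | s in `[0%R, t]%classic].

Section fixed_time.
Variable t : R.
Hypothesis t0 : (0 < t)%R.

Let h n := mesh t n.
Let N n := (2 ^ n)%N.
Let h_ge0 n : (0 <= h n)%R. Proof. exact/ltW/mesh_gt0. Qed.
Let indep := levy_independent levyZ.
Let stat := levy_stationary levyZ.

Lemma cvg_depth w : (- low Z (h n) (N n) w)%:E @[n --> \oo] --> depth t w.
Proof. exact: (cvg_grid_min t0 (levy_cadlag levyZ w)). Qed.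

Lemma depth_ge n w : (- low Z (h n) (N n) w)%:E <= depth t w.
Proof.
have [i i_n] := running_minP (fun i => sample Z (h n) i w) (N n).
rewrite /low => ->; apply: ereal_sup_ubound; exists (i%:R * h n)%R => //=.
by rewrite in_itv/=; exact: grid_in.
Qed.

Lemma depth_ge_path s w : (0 <= s <= t)%R -> (- Z s w)%:E <= depth t w.
Proof.
by move=> st; apply: ereal_sup_ubound; exists s => //=; rewrite in_itv.
Qed.

Lemma depth_ge0 w : 0 <= depth t w.
Proof.
have := @depth_ge_path 0%R w; rewrite Z0 oppr0; apply.
by rewrite lexx ltW.
Qed.

Lemma depth_lty w : depth t w < +oo.
Proof.
have [C Cb] := cadlag_bounded t (levy_cadlag levyZ w).
apply: (@le_lt_trans _ _ C%:E); last exact: ltry.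
apply: ge_ereal_sup => _ /= [s + <-]; rewrite in_itv/= => /Cb.
by rewrite lee_fin /Defs.path; have := ler_norm (- Z s w)%R; rewrite normrN; lra.
Qed.

Lemma measurable_depth : measurable_fun setT (depth t).
Proof.
apply: (@emeasurable_fun_cvg _ _ _ _ (fun n w => (- low Z (h n) (N n) w)%:E)).
  move=> n; apply/measurable_EFinP; apply: measurableT_comp => //.
  exact: measurable_low.
by move=> w _; exact: cvg_depth.
Qed.

Lemma cvg_expected_depth :
  \int[P]_w (- low Z (h n) (N n) w)%:E @[n --> \oo] --> \int[P]_w depth t w.
Proof.
have -> : \int[P]_w depth t w =
    \int[P]_w limn (fun n => (- low Z (h n) (N n) w)%:E).
  by apply: eq_integral => w _; apply/esym/cvg_lim => //; exact: cvg_depth.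
apply: cvg_monotone_convergence => //.
- move=> n; apply/measurable_EFinP; apply: measurableT_comp => //.
  exact: measurable_low.
- by move=> n w _; rewrite lee_fin oppr_ge0 low_le0.
- move=> w _ m n mn; rewrite lee_fin lerN2.
  exact: (@grid_min_nonincreasing R t (Defs.path Z w) m n mn).
Qed.

Definition gradual e n := [set w | forall k, (k < N n)%N ->
  (sample Z (h n) k w - e <= sample Z (h n) k.+1 w)%R].

Lemma ae_gradual e : (0 < e)%R -> {ae P, forall w, \forall n \near \oo, gradual e n w}.
Proof.
move=> e0; apply: filterS posZ => w posw.
have [q q0 Hq] := cadlag_no_negative_jump t (levy_cadlag levyZ w) posw e0.
have := @cvg_mesh R t; move=> /cvgr_lt /(_ _ q0) hq.
near=> n => k kn; apply: Hq.
- by rewrite mulr_ge0.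
- by rewrite ler_wpM2r// ler_nat.
- by have /andP[] := grid_in t0 kn.
- rewrite -mulrBl -natr1 addrAC subrr add0r mul1r.
  by near: n.
Unshelve. all: by end_near. Qed.

Let tail c := P [set w | c%:E < depth t w].

Let measurable_tail c : measurable [set w | c%:E < depth t w].
Proof.
by rewrite -[X in measurable X]setTI; exact: (emeasurable_fun_o_infty measurableT measurable_depth).
Qed.

Lemma measurable_gradual e n : measurable (gradual e n).
Proof.
rewrite (_ : gradual e n = \bigcap_(k in `I_(N n))
   [set w | (sample Z (h n) k w - e <= sample Z (h n) k.+1 w)%R]).
  apply: bigcap_measurableType => k _; apply: measurable_set_le; last first.
    exact: measurable_sample.
  by apply: measurable_funB => //; exact: measurable_sample.
by apply/seteqP; split.
Qed.

(** Almost every path is eventually gradual, so the event that the depth exceeds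
    [a + b + e] is almost contained in the increasing union of the events that
    it is seen to do so, gradually, on all grids from some index on. *)
Let tail_submul a b e : (0 <= a)%R -> (0 <= b)%R -> (0 < e)%R ->
  tail (a + b + e) <= tail a * tail b.
Proof.
move=> a0 b0 e0.
pose A n := [set w | (low Z (h n) (N n) w < - (a + b + e))%R] `&` gradual e n.
have mA n : measurable (A n).
  apply: measurableI; last exact: measurable_gradual.
  apply: measurable_set_lt => //.
  exact: measurable_low.
have mtail c n : measurable [set w | (low Z (h n) (N n) w < - c)%R].
  by apply: measurable_set_lt => //; exact: measurable_low.
have PJ c n : P [set w | (low Z (h n) (N n) w < - c)%R] <= tail c.
  apply: le_measure; rewrite ?inE//.
  move=> w /= Jc; apply: lt_le_trans (depth_ge n w).
  by rewrite lte_fin ltrNr.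
have PA n : P (A n) <= tail a * tail b.
  apply: le_trans (tail_submultiplicative indep stat Z0 (h_ge0 n) (N n) a0 b0 (ltW e0)) _.
  by apply: lee_pmul.
(* The lower limit of the events [A n]. *)
pose E m := \bigcap_(n in [set n | (m <= n)%N]) A n.
have mE m : measurable (E m) by apply: bigcap_measurableType.
have PE : P (\bigcup_m E m) <= tail a * tail b.
  have cvE : P \o E @ \oo --> P (\bigcup_m E m).
    apply: nondecreasing_cvg_mu => //; first exact: bigcup_measurable.
    move=> m n mn; apply/subsetPset => w Ew k /= nk; apply: Ew => /=.
    exact: leq_trans nk.
  apply: cvge_le cvE; near=> m => /=.
  apply: le_trans (PA m); apply: le_measure; rewrite ?inE//.
  by move=> w; apply => /=.
apply: le_trans PE.
have [B [mB B0 goodB]] := ae_gradual e0.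
rewrite -[leRHS]adde0 -B0; apply: le_trans (measureU2 _ _ _) => //; last first.
  exact: bigcup_measurable.
apply: le_measure; rewrite ?inE//.
  by apply: measurableU => //; exact: bigcup_measurable.
move=> w /= wc; have [Bw|Bw] := pselect (B w); [by right|left].
have {Bw} [m1 _ m1good] : \forall n \near \oo, gradual e n w.
  by apply: contrapT => ngood; apply: Bw; exact: goodB.
have nb : nbhs (depth t w) [set y | (a + b + e)%:E < y].
  by apply: open_nbhs_nbhs; split => //; exact: open_ereal_gt_ereal.
have [m2 _ m2J] := cvg_depth nb.
exists (maxn m1 m2) => // n /=; rewrite geq_max => /andP[m1n m2n]; split.
  by have /= := m2J n m2n; rewrite lte_fin ltrNr.
exact: m1good.
Unshelve. all: by end_near. Qed.

(** Some level [b] has tail at most one half, as the depth is finite.  By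
    submultiplicativity the tail at [m * (b + 1)] is then at most [2 ^- m], and
    the depth is at most [b + 1] times one plus the number of the levels
    [m * (b + 1)] that it exceeds. *)
Lemma expected_depth_lty : \int[P]_w depth t w < +oo.
Proof.
have [b b0 tb] : exists2 b, (0 <= b)%R & tail b <= (2^-1)%:E.
  have cvt : P \o (fun n => [set w | n%:R%:E < depth t w]) @ \oo -->
      P (\bigcap_n [set w | n%:R%:E < depth t w]).
    apply: nonincreasing_cvg_mu => //.
    - by rewrite (le_lt_trans (probability_le1 P _))// ltry.
    - exact: bigcap_measurable.
    - move=> m n mn; apply/subsetPset => w /=; apply: le_lt_trans.
      by rewrite lee_fin ler_nat.
  have cap0 : \bigcap_n [set w | n%:R%:E < depth t w] = set0.
    apply/seteqP; split => // w /= Hw.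
    have fd : depth t w \is a fin_num by rewrite ge0_fin_numE ?depth_ge0 ?depth_lty.
    have := Hw (Num.truncn (fine (depth t w))).+1 I => /=.
    rewrite -[X in _ < X]fineK// lte_fin ltNge => /negP; apply.
    have /truncn_itv/andP[_ /ltW] : (0 <= fine (depth t w))%R.
      by rewrite fine_ge0 ?depth_ge0.
    by [].
  move: cvt; rewrite cap0 measure0.
  have nb : nbhs (0 : \bar R) [set y | y < (2^-1)%:E].
    by apply: open_nbhs_nbhs; split; [exact: open_ereal_lt_ereal|rewrite /= lte_fin].
  move=> /(_ _ nb)[n _ Hn].
  exists n%:R => //; apply/ltW; exact: (Hn n (leqnn n)).
pose B := (b + 1)%R.
have B0 : (0 < B)%R by rewrite ltr_wpDl.
have tailB m : tail (m%:R * B) <= (2^-1 ^+ m)%:E.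
  elim: m => [|m IH]; first by rewrite expr0; exact: probability_le1.
  rewrite -natr1 mulrDl mul1r /B addrA.
  apply: (le_trans (tail_submul _ b0 ltr01)).
    by rewrite mulr_ge0// ltW.
  rewrite exprSr EFinM; apply: lee_pmul => //.
pose F m (w : T) : \bar R := (B * \1_[set v | ((m%:R * B)%:E < depth t v)%E] w)%:E.
have mF m : measurable_fun setT (F m).
  by apply/measurable_EFinP; exact: measurable_funM.
have F0 m w : 0 <= F m w by rewrite lee_fin mulr_ge0// ltW.
have depthF w : depth t w <= B%:E + \sum_(m <oo) F m w.
  have fd : depth t w \is a fin_num by rewrite ge0_fin_numE ?depth_ge0 ?depth_lty.
  have x0 : (0 <= fine (depth t w))%R by rewrite fine_ge0 ?depth_ge0.
  (* The levels [m * B] with [m < k] lie strictly below the depth. *)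
  set k := Num.truncn (fine (depth t w) / B).
  have /truncn_itv/andP[k1 k2] : (0 <= fine (depth t w) / B)%R.
    by rewrite divr_ge0// ltW.
  apply: (@le_trans _ _ (B%:E + \sum_(0 <= m < k) F m w)); last first.
    by rewrite leeD2l//; apply: nneseries_lim_ge.
  rewrite (_ : \sum_(0 <= m < k) F m w = (k%:R * B)%:E).
    rewrite -[leLHS]fineK// -EFinD lee_fin.
    rewrite addrC -{2}[B]mul1r -mulrDl natr1 -ler_pdivrMr//; exact: ltW.
  transitivity (\sum_(0 <= m < k) B%:E).
    rewrite !big_nat; apply: eq_bigr => m /andP[_ mk].
    rewrite /F indicE mem_set ?mulr1//=.
    rewrite -[X in _ < X]fineK// lte_fin -ltr_pdivlMr//.
    by apply: lt_le_trans k1; rewrite ltr_nat.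
  by rewrite big_mkord sum_const_ereal -EFinM.
apply: (@le_lt_trans _ _ (\int[P]_w (B%:E + \sum_(m <oo) F m w))).
  apply: ge0_le_integral => //.
  - by move=> w _; exact: depth_ge0.
  - exact: measurable_depth.
  - by apply: emeasurable_funD => //; apply: ge0_emeasurable_sum.
rewrite ge0_integralD//; last 3 first.
- by move=> w _; rewrite lee_fin ltW.
- by move=> w _; apply: nneseries_ge0.
- by apply: ge0_emeasurable_sum.
have -> : \int[P]_w B%:E = B%:E.
  rewrite integral_cst// -[RHS]mule1; congr (_ * _).
  exact: probability_setT.
rewrite integral_nneseries//.
have FE m : \int[P]_w F m w <= (2 * B / (2 ^ m.+1)%:R)%:E.
  rewrite /F; under eq_integral do rewrite EFinM.
  rewrite ge0_integralZl//; last 2 first.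
  - by apply/measurable_EFinP; apply: measurable_indic; exact: measurable_tail.
  - by rewrite lee_fin ltW.
  rewrite integral_indic// setIT.
  rewrite (_ : (2 * B / _ = B * 2^-1 ^+ m)%R).
    rewrite [leRHS]EFinM; apply: lee_wpmul2l; last exact: tailB.
    by rewrite lee_fin ltW.
  by rewrite natrX exprS exprVn invfM mulrACA mulfV// mul1r.
apply: (@le_lt_trans _ _ (B%:E + (2 * B)%:E)); last by rewrite -EFinD ltry.
rewrite leeD2l//.
apply: (@le_trans _ _ (\sum_(m <oo) (2 * B / (2 ^ m.+1)%:R)%:E)).
  apply: lee_nneseries => [m _ _|m _]; last exact: FE.
  by apply: integral_ge0 => w _; exact: F0.
have := @cvg_geometric_eseries_half R (2 * B) 0.
rewrite expr0 divr1 => /cvg_lim H; rewrite -[leRHS]H//.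
by rewrite le_eqVlt; apply/orP; left; apply/eqP; apply: eq_eseriesr => m _; rewrite addn1.
Qed.

End fixed_time.
End drawdown.

(** * New minima that the endpoint finally exceeds *)

Lemma integral_indicator d (T : measurableType d) (R : realType)
    (mu : {measure set T -> \bar R}) (f : T -> R) (b : T -> bool) :
  \int[mu]_w (f w * (b w)%:R)%:E = \int[mu]_(w in [set w | b w]) (f w)%:E.
Proof.
rewrite [RHS]integral_mkcond; apply: eq_integral => w _; rewrite patchE.
case: (boolP (b w)) => bw; first by rewrite mem_set//= mulr1.
by rewrite memNset/= ?mulr0//; apply/negP.
Qed.

Section drawdown_limit.
Context d (T : measurableType d) (R : realType) (P : probability T R).
Variable (Z : R -> {RV P >-> R}).
Hypotheses (levyZ : levy_process Z) (posZ : spectrally_positive Z).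
Hypothesis Z0 : forall w, Z 0%R w = 0%R.
Variable t : R.
Hypothesis t0 : (0 < t)%R.

Let h n := mesh t n.
Let N n := (2 ^ n)%N.
Let h_ge0 n : (0 <= h n)%R. Proof. exact/ltW/mesh_gt0. Qed.
Let indep := levy_independent levyZ.
Let stat := levy_stationary levyZ.

Definition neg_part s w : R := Num.max 0%R (- Z s w)%R.

Lemma measurable_neg_part s : measurable_fun setT (neg_part s).
Proof. by apply: measurable_maxr => //; exact: measurableT_comp. Qed.

Lemma neg_part_ge0 s w : (0 <= neg_part s w)%R.
Proof. by rewrite /neg_part le_max lexx. Qed.

Lemma neg_part_le s w : (0 <= s <= t)%R -> (neg_part s w)%:E <= depth Z t w.
Proof.
move=> st; rewrite /neg_part.
have [H|H] := leP 0%R (- Z s w)%R; first exact: depth_ge_path.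
exact: (depth_ge0 Z0 t0).
Qed.

Lemma integrable_depth : P.-integrable setT (depth Z t).
Proof.
apply/integrableP; split; first exact: measurable_depth.
under eq_integral do rewrite gee0_abs ?depth_ge0//.
exact: expected_depth_lty.
Qed.

(** Whether the path ends above its value after step [k.+1] is decided by the
    later increments, which are independent of the new low; this is why the
    expectation of the product factors. *)
Definition late_low n k w : R :=
  (new_low Z (h n) k w * (sample Z (h n) k.+1 w < sample Z (h n) (N n) w)%R%:R)%R.

Lemma measurable_late_low n k : measurable_fun setT (late_low n k).
Proof.
apply: measurable_funM; first exact: measurable_new_low.
rewrite (_ : (fun w => _) = \1_[set w | (sample Z (h n) k.+1 w < sample Z (h n) (N n) w)%R]).
  by apply: measurable_indic; apply: measurable_set_lt; exact: measurable_sample.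
apply/funext => w; rewrite indicE.
case: (boolP (sample Z (h n) k.+1 w < sample Z (h n) (N n) w)%R) => H.
  by rewrite mem_set.
by rewrite memNset//=; exact/negP.
Qed.

Lemma late_low_ge0 n k w : (0 <= late_low n k w)%R.
Proof. by rewrite mulr_ge0// ?new_low_ge0. Qed.

Lemma late_low_le n k w : (late_low n k w <= new_low Z (h n) k w)%R.
Proof. by rewrite ler_piMr ?new_low_ge0// lern1 leq_b1. Qed.

Lemma sample_last n w : sample Z (h n) (N n) w = Z t w.
Proof. by rewrite /sample mesh_last. Qed.

(** On a gradual path the sum is within a small [e] of the depth seen on the
    grid.  The domination by twice the depth comes from the telescoping sum of
    all new lows. *)
Lemma cvg_sum_late_low :
  \int[P]_w (\sum_(k < N n) late_low n k w + neg_part t w)%:E @[n --> \oo]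
    --> \int[P]_w depth Z t w.
Proof.
have [] // := @dominated_convergence _ _ _ P setT measurableT
  (fun n w => (\sum_(k < N n) late_low n k w + neg_part t w)%:E)
  (depth Z t) (fun w => depth Z t w + depth Z t w).
- move=> n; apply/measurable_EFinP; apply: measurable_funD.
    by apply: measurable_sum => k; exact: measurable_late_low.
  exact: measurable_neg_part.
- exact: measurable_depth.
- (* Countably many tolerances, so that one null set serves them all. *)
  have e_ m : (0 < m.+1%:R^-1 :> R)%R by rewrite invr_gt0.
  have /ae_foralln := fun m => ae_gradual levyZ posZ t0 (e_ m).
  apply: filterS => w grad _.
  have fd : depth Z t w \is a fin_num.
    by rewrite ge0_fin_numE ?depth_ge0// depth_lty.
  rewrite -(fineK fd); apply: cvg_EFin; first by near=> n.
  have cJ : (- low Z (h n) (N n) w)%R @[n --> \oo] --> fine (depth Z t w).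
    by have := @cvg_depth _ _ _ _ _ levyZ t t0 w; rewrite -[X in _ --> X]fineK// => /fine_cvg.
  apply/cvgrPdist_lt => e e0.
  have e20 : (0 < e / 2)%R by rewrite divr_gt0.
  have [m _ me] : \forall m \near \oo, (m.+1%:R^-1 < e / 2)%R.
    have := @cvg_harmonic R => /cvgr_lt /(_ _ e20) [m _ Hm].
    by exists m => // k mk; exact: (Hm k mk).
  near=> n.
  have /andP[A1 A2] : (- low Z (h n) (N n) w <=
      \sum_(k < N n) late_low n k w + neg_part t w <=
      - low Z (h n) (N n) w + m.+1%:R^-1)%R.
    rewrite /neg_part -(sample_last n w).
    apply: (sum_drops_endpoint (f := fun i => sample Z (h n) i w)) => //.
      exact: sample0.
    by near: n; exact: grad.
  have : (`|fine (depth Z t w) - - low Z (h n) (N n) w| < e / 2)%R.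
    by near: n; move/cvgrPdist_lt : cJ; apply.
  have : (m.+1%:R^-1 < e / 2)%R := me m (leqnn m).
  rewrite -[(fine \o _) n]/(\sum_(k < N n) late_low n k w + neg_part t w)%R.
  move: A1 A2; set A := (\sum_(k < N n) _ + _)%R.
  move: (m.+1%:R^-1)%R A (low _ _ _ _) => delta A Jn; rewrite !ltr_norml.
  by move=> ? ? ? /andP[? ?]; apply/andP; split; lra.
- by have := integrableD measurableT integrable_depth integrable_depth.
- apply: aeW => w n _; rewrite gee0_abs ?lee_fin; last first.
    by rewrite addr_ge0 ?neg_part_ge0// sumr_ge0// => k _; exact: late_low_ge0.
  rewrite EFinD; apply: leeD; last by apply: neg_part_le; rewrite lexx ltW.
  apply: le_trans _ (depth_ge Z t0 n w); rewrite lee_fin.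
  have := @sum_drops _ (fun i => sample Z (h n) i w) (sample0 _ Z0 w) (N n).
  move=> <-; apply: ler_sum => k _; exact: late_low_le.
Unshelve. all: by end_near. Qed.

Lemma expected_late_low n k : (k < N n)%N ->
  \int[P]_w (late_low n k w)%:E =
  P [set w | (0 < Z (t - k.+1%:R * h n)%R w)%R] *
  (k.+1%:R^-1)%:E * \int[P]_w (neg_part (k.+1%:R * h n) w)%:E.
Proof.
move=> kN; rewrite integral_indicator.
have := expected_new_low_future indep stat Z0 (h_ge0 n) k (N n - k.+1).
rewrite subnKC// => ->; rewrite -muleA; congr (_ * _).
  congr (P _); apply/funext => w.
  rewrite /sample; congr (is_true (_ < Z _ w)%R).
  by rewrite natrB// mulrBl mesh_last.
rewrite -(expected_new_low indep stat Z0 (h_ge0 n) k) muleA -EFinM mulVf ?mul1e//.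
Qed.

Lemma sum_early_late_low n e w : (0 < e)%R ->
  (\sum_(k < N n | (k.+1%:R * h n < e)%R) late_low n k w)%:E <= depth Z e w.
Proof.
move=> e0.
have [i j ij||K /andP[KN Ke] le] := @sum_early_drops R (fun i => sample Z (h n) i w) (sample0 _ Z0 w)
  (fun k => (k%:R * h n < e)%R) (N n).
- by apply: le_lt_trans; rewrite ler_wpM2r// ler_nat.
- by rewrite mul0r.
apply: (@le_trans _ _ (- low Z (h n) K w)%:E).
  rewrite lee_fin (le_trans _ le)//; apply: ler_sum => k _; exact: late_low_le.
have [i i_K JS] := running_minP (fun i => sample Z (h n) i w) K.
rewrite /low JS; apply: depth_ge_path; rewrite mulr_ge0//=.
by rewrite (le_trans _ (ltW Ke))// ler_wpM2r// ler_nat.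
Qed.

End drawdown_limit.

(** * Riemann sums at right endpoints *)

Section riemann_sums.
Context {R : realType}.
Variable t : R.
Hypothesis t0 : (0 < t)%R.
Let h n := mesh t n.
Let h_gt0 n : (0 < h n)%R. Proof. exact: mesh_gt0. Qed.

Definition cell n k : set R := `[(k%:R * h n)%R, (k.+1%:R * h n)%R[.

(** The step function that takes on each cell the value of [f] at the right
    endpoint; its integral is the Riemann sum, and right continuity of [f] along
    the grids suffices for its convergence. *)
Definition right_sum (f : R -> R) n : R -> R :=
  fun s => (\sum_(k < 2 ^ n) f (k.+1%:R * h n) * \1_(cell n k) s)%R.

Lemma in_cell n k s : (0 <= s)%R -> (s \in cell n k) = (k.+1 == next_index t n s).
Proof.
move=> s0; have /andP[sn1 sn2] := next_index_itv t0 n s0.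
have sh0 : (0 <= s / h n)%R := divr_ge0 s0 (ltW (h_gt0 n)).
have sn3 : ((Num.truncn (s / h n))%:R * h n <= s)%R.
  by rewrite -ler_pdivlMr// truncn_le.
rewrite mem_setE /= in_itv/=.
apply/andP/eqP => [[k1 k2]|[->]]; last by split.
apply/eqP; rewrite eqn_leq; apply/andP; split.
  rewrite /next_index ltnS truncn_ge_nat//.
  by rewrite ler_pdivlMr.
rewrite /next_index truncn_lt_nat//.
by rewrite ltr_pdivrMr.
Qed.

Lemma right_sumE f n s : (0 <= s < t)%R ->
  right_sum f n s = f ((next_index t n s)%:R * h n)%R.
Proof.
move=> /[dup] st /andP[s0 _]; have sN := next_index_le t0 n st.
rewrite /right_sum (bigD1 (Ordinal sN))//= indicE in_cell// eqxx mulr1.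
rewrite big1 ?addr0// => k kN; rewrite indicE in_cell//.
case: eqP => [[kE]|_]; last by rewrite mulr0.
by move/eqP: kN; case; apply: val_inj.
Qed.

Lemma measurable_right_sum f n : measurable_fun setT (right_sum f n).
Proof.
apply: measurable_sum => k; apply: measurable_funM => //.
by apply: measurable_indic; exact: measurable_itv.
Qed.

Lemma integral_right_sum f n : (forall s, (0 <= s <= t)%R -> (0 <= f s)%R) ->
  \int[lebesgue_measure]_(s in `[0%R, t[) (right_sum f n s)%:E =
  (\sum_(k < 2 ^ n) f (k.+1%:R * h n) * h n)%:E.
Proof.
move=> f0; have fk0 (k : 'I_(2 ^ n)) : (0 <= f (k.+1%:R * h n))%R.
  by apply/f0/(grid_in t0).
under eq_integral do rewrite -sumEFin.
rewrite ge0_integral_sum//; last 2 first.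
- move=> k; apply/measurable_EFinP/measurable_funM => //.
  by apply: measurable_indic; exact: measurable_itv.
- by move=> k s _; rewrite lee_fin mulr_ge0.
rewrite -sumEFin; apply: eq_bigr => k _.
under eq_integral do rewrite EFinM.
rewrite ge0_integralZl//; last 2 first.
- apply/measurable_EFinP; apply: measurable_indic; exact: measurable_itv.
- by rewrite lee_fin.
rewrite integral_indic; [|exact: measurable_itv|exact: measurable_itv].
rewrite [RHS]EFinM; congr (_ * _).
have khk : (k%:R * h n < k.+1%:R * h n)%R by rewrite ltr_pM2r// ltr_nat.
rewrite setIidl.
  apply: etrans (lebesgue_measure_itv _) _; rewrite /= lte_fin khk -EFinD; congr (_%:E).
  by rewrite -natr1; lra.
apply: subset_itv; rewrite bnd_simp.
  by rewrite mulr_ge0// ltW.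
by have /andP[] := grid_in t0 (ltn_ord k).
Qed.

Lemma cvg_integral_right_sum (f : R -> R) (C : R) :
  (forall s, (0 <= s <= t)%R -> (0 <= f s <= C)%R) ->
  (forall s, (0 <= s < t)%R -> f ((next_index t n s)%:R * h n)%R @[n --> \oo] --> f s) ->
  measurable_fun `[0%R, t[%classic f /\
  (\sum_(k < 2 ^ n) f (k.+1%:R * h n) * h n)%:E @[n --> \oo] -->
  \int[lebesgue_measure]_(s in `[0%R, t[) (f s)%:E.
Proof.
move=> fC fcvg.
have cvg_rs s : (0 <= s < t)%R -> right_sum f n s @[n --> \oo] --> f s.
  by move=> st; under eq_fun do rewrite right_sumE//; exact: fcvg.
have mf : measurable_fun `[0%R, t[%classic f.
  apply: (@measurable_fun_cvg _ _ _ _ (right_sum f)).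
    by move=> n; apply: measurable_funTS; exact: measurable_right_sum.
  by move=> s /=; rewrite in_itv/=; exact: cvg_rs.
split=> //.
have f0 s : (0 <= s <= t)%R -> (0 <= f s)%R by move=> /fC/andP[].
under eq_fun do rewrite -(integral_right_sum _ f0).
have [] // := @dominated_convergence _ _ _ lebesgue_measure `[0%R, t[%classic
  (measurable_itv _) (fun n s => (right_sum f n s)%:E) (fun s => (f s)%:E)
  (fun=> C%:E).
- move=> n; apply/measurable_EFinP; apply: measurable_funTS.
  exact: measurable_right_sum.
- exact/measurable_EFinP.
- apply: aeW => s /=; rewrite in_itv/= => st; apply: cvg_EFin; first by near=> n.
  exact: cvg_rs.
- apply/integrableP; split; first exact: measurable_cst.
  rewrite integral_cst//= lebesgue_measure_itv/= lte_fin t0 -EFinD -EFinM.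
  exact: ltry.
- apply: aeW => s n /=; rewrite in_itv/= => st; rewrite right_sumE//.
  have /andP[] := fC ((next_index t n s)%:R * h n)%R (grid_in t0 (next_index_le t0 n st)).
  by move=> ? ?; rewrite lee_fin ger0_norm.
Unshelve. all: by end_near. Qed.

End riemann_sums.

(** * The expected depth *)

Lemma neg_part_lip (R : realType) (a b : R) :
  (`|Num.max 0 (- a) - Num.max 0 (- b)| <= `|a - b|)%R.
Proof.
have := ler_norm (a - b)%R; have := ler_norm (b - a)%R; rewrite (distrC b a).
by rewrite ler_norml; have [?|?] := leP 0%R (- a)%R; have [?|?] := leP 0%R (- b)%R;
  move=> ? ?; apply/andP; split; lra.
Qed.

Section expected_drawdown.
Context d (T : measurableType d) (R : realType) (P : probability T R).
Variable (Z : R -> {RV P >-> R}).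
Hypotheses (levyZ : levy_process Z) (posZ : spectrally_positive Z).
Hypothesis Z0 : forall w, Z 0%R w = 0%R.
Hypothesis no_atom : forall s, (0 < s)%R -> P [set w | Z s w = 0%R] = 0.
Variable t : R.
Hypothesis t0 : (0 < t)%R.

Let h n := mesh t n.
Let N n := (2 ^ n)%N.
Let h_gt0 n : (0 < h n)%R. Proof. exact: mesh_gt0. Qed.
Let stat := levy_stationary levyZ.
Let s_ n s := ((next_index t n s)%:R * h n)%R.

Let s_in n s : (0 <= s < t)%R -> (0 <= s_ n s <= t)%R.
Proof. by move=> st; apply: (grid_in t0); exact: (next_index_le t0). Qed.

Let cvg_s_ s w : (0 <= s)%R -> Z (s_ n s) w @[n --> \oo] --> Z s w.
Proof. by move=> s0; exact: (cvg_path_next_index t0 (levy_cadlag levyZ w) s0). Qed.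

Definition mean_neg s := \int[P]_w (neg_part Z s w)%:E.
Definition prob_pos s := P [set w | (0 < Z s w)%R].

(** The integrand.  The values of [fine] are taken at finite quantities for
    [0 <= s <= t]. *)
Definition rate s : R := (fine (prob_pos (t - s)) * s^-1 * fine (mean_neg s))%R.

Lemma mean_neg_le s : (0 <= s <= t)%R -> mean_neg s <= \int[P]_w depth Z t w.
Proof.
move=> st; apply: ge0_le_integral => //.
- by move=> w _; rewrite lee_fin neg_part_ge0.
- by apply/measurable_EFinP; exact: measurable_neg_part.
- exact: (measurable_depth levyZ t0).
- by move=> w _; exact: (neg_part_le Z0 t0).
Qed.

Lemma mean_neg_ge0 s : 0 <= mean_neg s.
Proof. by apply: integral_ge0 => w _; rewrite lee_fin neg_part_ge0. Qed.

Lemma mean_neg_fin s : (0 <= s <= t)%R -> mean_neg s \is a fin_num.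
Proof.
move=> st; rewrite ge0_fin_numE ?mean_neg_ge0//.
apply: le_lt_trans (mean_neg_le st) _.
exact: (expected_depth_lty levyZ posZ Z0 t0).
Qed.

Lemma prob_pos_fin s : prob_pos s \is a fin_num.
Proof.
by apply: fin_num_measure; exact: measurable_set_lt.
Qed.

Let cvg_mean_neg s : (0 <= s < t)%R ->
  fine (mean_neg (s_ n s)) @[n --> \oo] --> fine (mean_neg s).
Proof.
move=> /[dup] st /andP[s0 /ltW st'].
apply: fine_cvg; rewrite fineK ?mean_neg_fin ?s0//.
have [] // := @dominated_convergence _ _ _ P setT measurableT
  (fun n w => (neg_part Z (s_ n s) w)%:E) (fun w => (neg_part Z s w)%:E)
  (depth Z t).
- by move=> n; apply/measurable_EFinP; exact: measurable_neg_part.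
- by apply/measurable_EFinP; exact: measurable_neg_part.
- apply: aeW => w _; apply: cvg_EFin; first by near=> n.
  apply/cvgrPdist_lt => e e0; have /cvgrPdist_lt /(_ e e0) := @cvg_s_ s w s0.
  by apply: filterS => n /=; apply: le_lt_trans; exact: neg_part_lip.
- exact: (integrable_depth levyZ posZ Z0 t0).
- apply: aeW => w n _; rewrite gee0_abs ?lee_fin ?neg_part_ge0//.
  by apply: (neg_part_le Z0 t0); exact: s_in.
Unshelve. all: by end_near. Qed.

(** By stationarity the event may be moved to a fixed endpoint, so that [s] moves
    instead of [t - s] and only right limits of the path occur. *)
Let prob_pos_incr s : (0 <= s <= t)%R ->
  prob_pos (t - s) = \int[P]_w (\1_[set v | (Z s v < Z t v)%R] w)%:E.
Proof.
move=> /andP[s0 st].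
have mA : measurable [set v | (Z s v < Z t v)%R] by exact: measurable_set_lt.
rewrite integral_indic// setIT.
transitivity (P (Z (t - s)%R @^-1` `]0%R, +oo[)).
  congr (P _).
  by apply/seteqP; split => w /=; rewrite in_itv/= andbT.
apply: etrans (esym (stat s0 st (measurable_itv `]0%R, +oo[))) _.
rewrite (_ : increment Z s t @^-1` `]0%R, +oo[ = [set v | (Z s v < Z t v)%R])//.
by apply/seteqP; split => w /=; rewrite /increment in_itv/= andbT subr_gt0.
Qed.

(** The indicators converge except on the tie [Z s = Z t], which has the
    probability of [Z (t - s) = 0]. *)
Let cvg_prob_pos s : (0 <= s < t)%R ->
  fine (prob_pos (t - s_ n s)) @[n --> \oo] --> fine (prob_pos (t - s)).
Proof.
move=> /[dup] st /andP[s0 st'].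
apply: fine_cvg; rewrite fineK ?prob_pos_fin//.
rewrite prob_pos_incr ?s0 ?ltW//.
under eq_fun do rewrite prob_pos_incr ?s_in//.
have mI u : measurable_fun setT (fun w => (\1_[set v | (Z u v < Z t v)%R] w)%:E : \bar R).
  by apply/measurable_EFinP; apply: measurable_indic; exact: measurable_set_lt.
have [] // := @dominated_convergence _ _ _ P setT measurableT
  (fun n w => (\1_[set v | (Z (s_ n s) v < Z t v)%R] w)%:E)
  (fun w => (\1_[set v | (Z s v < Z t v)%R] w)%:E) (fun=> 1%:E).
- exists [set w | (Z t w - Z s w)%R = 0%R]; split.
  + rewrite -[X in measurable X]setTI.
    have mf : measurable_fun setT (fun w => Z t w - Z s w)%R by exact: measurable_funB.
    exact: (mf measurableT _ (measurable_set1 0%R)).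
  + rewrite -[RHS](@no_atom (t - s)%R) ?subr_gt0//.
    exact: (stat s0 (ltW st') (measurable_set1 0%R)).
  + move=> w /= nw; apply: contrapT => /eqP; rewrite subr_eq0 => neq; apply: nw => _.
    apply: cvg_near_cst; have cz := @cvg_s_ s w s0.
    have [lt|lt|eq] := ltgtP (Z s w) (Z t w); last by rewrite eq eqxx in neq.
      have := cz; move=> /cvgr_lt /(_ _ lt); apply: filterS => n /= ltn.
      by rewrite !indicE !mem_set.
    have := cz; move=> /cvgr_gt /(_ _ lt); apply: filterS => n /= ltn.
    by rewrite !indicE !memNset//=; apply/negP; rewrite -leNgt ltW.
- exact: finite_measure_integrable_cst.
- by apply: aeW => w n _; rewrite lee_fin indicE; case: (_ \in _); rewrite /= ?normr1 ?normr0.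
Qed.

(** Cutting at [e <= s], with a weak inequality, keeps the convergence at [e]
    itself along grid points that approach it from the right. *)
Definition cut_rate e s : R := if (e <= s)%R then rate s else 0%R.

Lemma rate_ge0 s : (0 <= s)%R -> (0 <= rate s)%R.
Proof.
move=> s0; rewrite /rate !mulr_ge0 ?invr_ge0// fine_ge0//.
exact: mean_neg_ge0.
Qed.

Lemma cut_rate_bound e s : (0 < e)%R -> (0 <= s <= t)%R ->
  (0 <= cut_rate e s <= e^-1 * fine (\int[P]_w depth Z t w))%R.
Proof.
move=> e0 st; have /andP[s0 _] := st.
have fd : \int[P]_w depth Z t w \is a fin_num.
  rewrite ge0_fin_numE; first exact: (expected_depth_lty levyZ posZ Z0 t0).
  by apply: integral_ge0 => w _; exact: (depth_ge0 Z0 t0).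
have d0 : (0 <= fine (\int[P]_w depth Z t w))%R.
  by rewrite fine_ge0//; apply: integral_ge0 => w _; exact: (depth_ge0 Z0 t0).
rewrite /cut_rate; case: ifPn => [es|_]; last first.
  by rewrite lexx/= mulr_ge0// invr_ge0 ltW.
rewrite rate_ge0//= /rate; apply: ler_pM.
- by rewrite mulr_ge0 ?invr_ge0// fine_ge0.
- by rewrite fine_ge0// mean_neg_ge0.
- rewrite -[leRHS]mul1r; apply: ler_pM; rewrite ?invr_ge0 ?fine_ge0//.
    rewrite -lee_fin fineK ?prob_pos_fin//; apply: probability_le1.
    by apply: measurable_set_lt.
  by rewrite lef_pV2// posrE (lt_le_trans e0).
- by rewrite fine_le// ?mean_neg_fin ?mean_neg_le.
Qed.

Lemma cvg_cut_rate e s : (0 < e)%R -> (0 <= s < t)%R ->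
  cut_rate e (s_ n s) @[n --> \oo] --> cut_rate e s.
Proof.
move=> e0 st; have /andP[s0 _] := st; rewrite {2}/cut_rate.
have cs : s_ n s @[n --> \oo] --> s by exact: (cvg_next_index t0 s0).
have s_s n : (s < s_ n s)%R by have /andP[] := next_index_itv t0 n s0.
case: ifPn => [es|]; last first.
  rewrite -ltNge => se; apply: cvg_near_cst.
  move/cvgr_lt : cs => /(_ _ se); apply: filterS => n /= ne.
  by rewrite /cut_rate leNgt ne.
have -> : (fun n => cut_rate e (s_ n s)) = (fun n => rate (s_ n s)).
  by apply/funext => n; rewrite /cut_rate (le_trans es (ltW (s_s n))).
apply: cvgM; last exact: cvg_mean_neg.
apply: cvgM; first exact: cvg_prob_pos.
by apply: cvgV => //; rewrite gt_eqF// (lt_le_trans e0).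
Qed.

Lemma expected_late_sum e n : (0 < e)%R ->
  \int[P]_w (\sum_(k < N n) late_low Z t n k w + neg_part Z t w)%:E =
  \int[P]_w (\sum_(k < N n | (k.+1%:R * h n < e)%R) late_low Z t n k w)%:E +
  ((\sum_(k < N n) cut_rate e (k.+1%:R * h n) * h n)%:E + mean_neg t).
Proof.
move=> e0.
have mE (p : pred 'I_(N n)) :
    measurable_fun setT (fun w => (\sum_(k < N n | p k) late_low Z t n k w)%:E).
  apply/measurable_EFinP; under eq_fun do rewrite big_mkcond.
  apply: measurable_sum => k; case: (p k) => //; exact: measurable_late_low.
have E0 (p : pred 'I_(N n)) w :
    0 <= (\sum_(k < N n | p k) late_low Z t n k w)%:E.
  by rewrite lee_fin sumr_ge0// => k _; exact: late_low_ge0.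
pose early := fun k : 'I_(N n) => (k.+1%:R * h n < e)%R.
transitivity (\int[P]_w ((\sum_(k < N n | early k) late_low Z t n k w)%:E +
  (\sum_(k < N n | ~~ early k) late_low Z t n k w)%:E + (neg_part Z t w)%:E)).
  by apply: eq_integral => w _; rewrite (bigID early)/= !EFinD.
rewrite ge0_integralD//; last 4 first.
- by move=> w _; rewrite adde_ge0.
- exact: emeasurable_funD.
- by move=> w _; rewrite lee_fin neg_part_ge0.
- by apply/measurable_EFinP; exact: measurable_neg_part.
rewrite ge0_integralD//.
rewrite -addeA; congr (_ + (_ + _)).
under eq_integral do rewrite big_mkcond -sumEFin.
rewrite ge0_integral_sum//; last 2 first.
- move=> k; apply/measurable_EFinP; case: (~~ early k) => //.
  exact: measurable_late_low.
- by move=> k w _; rewrite lee_fin; case: ifP => _ //; exact: late_low_ge0.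
rewrite -sumEFin; apply: eq_bigr => k _; rewrite /cut_rate leNgt.
rewrite /early; case: ifPn => /= ke; last first.
  by rewrite mul0r integral0.
rewrite (expected_late_low levyZ Z0 t0)// -/(prob_pos _) -/(mean_neg _).
have kt := grid_in t0 (ltn_ord k).
rewrite -[X in X * _ * _]fineK ?prob_pos_fin// -[X in _ * X]fineK ?mean_neg_fin//.
rewrite -!EFinM; congr (_%:E); rewrite /rate.
have hn0 : h n != 0%R by rewrite gt_eqF.
have k0 : k.+1%:R != 0%R :> R by [].
move: (fine _) (fine _) => p q.
by move: (h n) hn0 (k.+1%:R)%R k0 => H H0 K K0; field; rewrite H0.
Qed.

(** Before the limit, the expectation of the late lows is the Riemann sum of the
    cut rate plus the part of the steps before [e], which lies between 0 and the
    expected depth at [e]. *)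
Lemma expected_depth_bounds e : (0 < e)%R ->
  measurable_fun `[0%R, t[%classic (cut_rate e) /\
  \int[lebesgue_measure]_(s in `[0%R, t[) (cut_rate e s)%:E + mean_neg t
    <= \int[P]_w depth Z t w
    <= \int[P]_w depth Z e w +
       (\int[lebesgue_measure]_(s in `[0%R, t[) (cut_rate e s)%:E + mean_neg t).
Proof.
move=> e0.
have [mc cc] := cvg_integral_right_sum t0
  (fun s st => cut_rate_bound e0 st) (fun s st => cvg_cut_rate e0 st).
split=> //.
have cD := cvg_sum_late_low levyZ posZ Z0 t0.
have neg_fin : mean_neg t \is a fin_num by apply: mean_neg_fin; rewrite lexx ltW.
have cA : (\sum_(k < N n) cut_rate e (k.+1%:R * h n) * h n)%:E + mean_neg t @[n --> \oo]
    --> \int[lebesgue_measure]_(s in `[0%R, t[) (cut_rate e s)%:E + mean_neg t.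
  apply: cvgeD => //; last exact: cvg_cst.
  exact: fin_num_adde_defl.
have early_ge0 n : 0 <= \int[P]_w
    (\sum_(k < N n | (k.+1%:R * h n < e)%R) late_low Z t n k w)%:E.
  apply: integral_ge0 => w _.
  by rewrite lee_fin sumr_ge0// => k _; exact: late_low_ge0.
have early_le n : \int[P]_w
    (\sum_(k < N n | (k.+1%:R * h n < e)%R) late_low Z t n k w)%:E <=
    \int[P]_w depth Z e w.
  apply: ge0_le_integral => //.
  - by move=> w _; rewrite lee_fin sumr_ge0// => k _; exact: late_low_ge0.
  - apply/measurable_EFinP; under eq_fun do rewrite big_mkcond.
    apply: measurable_sum => k; case: (_ < e)%R => //; exact: measurable_late_low.
  - exact: (measurable_depth levyZ e0).
  - by move=> w _; exact: sum_early_late_low.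
apply/andP; split.
  apply: (lee_cvg_to cA cD); near=> n.
  by rewrite (expected_late_sum _ e0) leeDr.
have cB : \int[P]_w depth Z e w +
    ((\sum_(k < N n) cut_rate e (k.+1%:R * h n) * h n)%:E + mean_neg t) @[n --> \oo]
    --> \int[P]_w depth Z e w +
    (\int[lebesgue_measure]_(s in `[0%R, t[) (cut_rate e s)%:E + mean_neg t).
  apply: cvgeD => //; last exact: cvg_cst.
  rewrite fin_num_adde_defr// ge0_fin_numE.
    exact: (expected_depth_lty levyZ posZ Z0 e0).
  by apply: integral_ge0 => w _; exact: (depth_ge0 Z0 e0).
apply: (lee_cvg_to cD cB); near=> n.
by rewrite (expected_late_sum _ e0) leeD2r.
Unshelve. all: by end_near. Qed.

(** Right continuity at 0 makes the depth over a short interval vanish; the depth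
    at [t] dominates. *)
Lemma cvg_expected_depth0 :
  \int[P]_w depth Z (t / m.+1%:R) w @[m --> \oo] --> 0.
Proof.
have tm m : (0 < t / m.+1%:R)%R by rewrite divr_gt0.
have mono m w : depth Z (t / m.+1%:R) w <= depth Z t w.
  apply: ge_ereal_sup => _ /= [s + <-]; rewrite in_itv/= => /andP[s0 sm].
  apply: depth_ge_path; rewrite s0/= (le_trans sm)// ler_pdivrMr//.
  by rewrite ler_peMr ?(ltW t0)// ler1n.
have [] // := @dominated_convergence _ _ _ P setT measurableT
  (fun m => depth Z (t / m.+1%:R)) (fun=> 0) (depth Z t).
- by move=> m; exact: (measurable_depth levyZ (tm m)).
- apply: aeW => w _; apply/fine_cvgP; split.
    near=> m; rewrite ge0_fin_numE ?(depth_ge0 Z0 (tm m))//.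
    by apply: le_lt_trans (mono m w) _; exact: (depth_lty levyZ).
  apply/cvgrPdist_le => e e0.
  have [r r0 Hr] := cadlag_right (levy_cadlag levyZ w) (lexx 0%R) e0.
  have tm0 : (t / m.+1%:R)%R @[m --> \oo] --> 0%R.
    by rewrite -[X in _ --> X](mulr0 t); apply: cvgMr; exact: cvg_harmonic.
  have : \forall m \near \oo, (t / m.+1%:R < r)%R by move/cvgr_lt : tm0; apply.
  apply: filterS => m mr /=.
  have f0 : (0 <= fine (depth Z (t / m.+1%:R) w))%R.
    by rewrite fine_ge0// (depth_ge0 Z0 (tm m)).
  rewrite sub0r normrN ger0_norm//.
  rewrite -lee_fin fineK ?ge0_fin_numE ?(depth_ge0 Z0 (tm m))//; last first.
    by apply: le_lt_trans (mono m w) _; exact: (depth_lty levyZ).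
  apply: ge_ereal_sup => _ /= [s + <-]; rewrite in_itv/= => /andP[s0 sm].
  have := Hr s; rewrite s0 add0r (le_lt_trans sm mr)/= /Defs.path Z0 subr0 => /(_ isT).
  by rewrite lee_fin ltr_norml => /andP[? _]; lra.
- exact: (integrable_depth levyZ posZ Z0 t0).
- apply: aeW => w m _; rewrite gee0_abs ?mono// (depth_ge0 Z0 (tm m))//.
- by rewrite integral0.
Unshelve. all: by end_near. Qed.

Lemma expected_depthE :
  measurable_fun `]0%R, t[%classic rate /\
  \int[P]_w depth Z t w =
  mean_neg t + \int[lebesgue_measure]_(s in `]0%R, t[) (rate s)%:E.
Proof.
pose e m : R := (t / m.+1%:R)%R.
have e0 m : (0 < e m)%R by rewrite divr_gt0.
have sub : `]0%R, t[%classic `<=` (`[0%R, t[%classic : set R).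
  by apply: subset_itvr; rewrite bnd_simp.
have mcut m : measurable_fun `]0%R, t[%classic (cut_rate (e m)).
  have [mc _] := expected_depth_bounds (e0 m).
  exact: measurable_funS mc.
have e_cvg : e m @[m --> \oo] --> 0%R.
  by rewrite -[X in _ --> X](mulr0 t); apply: cvgMr; exact: cvg_harmonic.
have cut_cvg s : (0 < s)%R -> cut_rate (e m) s @[m --> \oo] --> rate s.
  move=> s0; apply: cvg_near_cst; move/cvgr_lt : e_cvg => /(_ _ s0).
  by apply: filterS => m /ltW; rewrite /cut_rate => ->.
have mrate : measurable_fun `]0%R, t[%classic rate.
  apply: (@measurable_fun_cvg _ _ _ _ (fun m => cut_rate (e m))) => // s /=.
  by rewrite in_itv/= => /andP[s0 _]; exact: cut_cvg.
split=> //.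
have cI : \int[lebesgue_measure]_(s in `]0%R, t[) (cut_rate (e m) s)%:E @[m --> \oo]
   --> \int[lebesgue_measure]_(s in `]0%R, t[) (rate s)%:E.
  have -> : \int[lebesgue_measure]_(s in `]0%R, t[) (rate s)%:E =
    \int[lebesgue_measure]_(s in `]0%R, t[) limn (fun m => (cut_rate (e m) s)%:E).
    apply: eq_integral => s; rewrite inE/= in_itv/= => /andP[s0 _].
    apply/esym/cvg_lim => //; apply: cvg_EFin; first by near=> m.
    exact: cut_cvg.
  apply: cvg_monotone_convergence => //.
  - by move=> m; apply/measurable_EFinP; exact: mcut.
  - move=> m s /=; rewrite in_itv/= => /andP[s0 _].
    by rewrite lee_fin /cut_rate; case: ifP => // _; rewrite rate_ge0// ltW.
  - move=> s /=; rewrite in_itv/= => /andP[s0 _] m n mn.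
    rewrite lee_fin /cut_rate; case: ifPn => [ms|_].
      rewrite (le_trans _ ms)// /e ler_pM2l// lef_pV2 ?posrE// ler_nat ltnS//.
    by case: ifP => // _; rewrite rate_ge0// ltW.
have neg_fin : mean_neg t \is a fin_num by apply: mean_neg_fin; rewrite lexx ltW.
have Eo m : \int[lebesgue_measure]_(s in `[0%R, t[) (cut_rate (e m) s)%:E =
    \int[lebesgue_measure]_(s in `]0%R, t[) (cut_rate (e m) s)%:E.
  by rewrite integral_itv_bndoo//; apply/measurable_EFinP; exact: mcut.
rewrite addeC.
have cA : \int[lebesgue_measure]_(s in `]0%R, t[) (cut_rate (e m) s)%:E + mean_neg t
   @[m --> \oo] -->
   \int[lebesgue_measure]_(s in `]0%R, t[) (rate s)%:E + mean_neg t.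
  apply: cvgeD => //; last exact: cvg_cst.
  exact: fin_num_adde_defl.
have cB : \int[P]_w depth Z (e m) w +
    (\int[lebesgue_measure]_(s in `]0%R, t[) (cut_rate (e m) s)%:E + mean_neg t)
   @[m --> \oo] --> 0 +
   (\int[lebesgue_measure]_(s in `]0%R, t[) (rate s)%:E + mean_neg t).
  apply: cvgeD => //; exact: cvg_expected_depth0.
rewrite add0e in cB.
apply/eqP; rewrite eq_le; apply/andP; split.
  apply: (cvge_ge _ cB); near=> m; rewrite -Eo.
  by have [_ /andP[]] := expected_depth_bounds (e0 m).
apply: (cvge_le _ cA); near=> m; rewrite -Eo.
by have [_ /andP[]] := expected_depth_bounds (e0 m).
Unshelve. all: by end_near. Qed.

End expected_drawdown.

(** * Centring, reflection and tail integrals *)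

Section affine_paths.
Context {R : realType}.
Local Close Scope ereal_scope.
Variables (f : R -> R) (k c : R).
Hypothesis cf : cadlag f.

Lemma cadlag_affine : cadlag (fun s => k * (f s - c)).
Proof.
split=> s s0.
  by apply: cvgM; [exact: cvg_cst|apply: cvgB; [exact: cf.1|exact: cvg_cst]].
apply/cvg_ex; exists (k * (lim (f y @[y --> s^'-]) - c)).
by apply: cvgM; [exact: cvg_cst|apply: cvgB; [exact: cf.2|exact: cvg_cst]].
Qed.

Lemma jump_affine s : 0 < s -> jump (fun s => k * (f s - c)) s = k * jump f s.
Proof.
move=> s0; rewrite /jump (_ : lim _ = k * (lim (f y @[y --> s^'-]) - c)).
  by ring.
apply: cvg_lim => //.
by apply: cvgM; [exact: cvg_cst|apply: cvgB; [exact: cf.2|exact: cvg_cst]].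
Qed.

End affine_paths.

Definition mk_RV d (T : measurableType d) (R : realType) (P : probability T R)
    (f : T -> R) (mf : measurable_fun setT f) : {RV P >-> R} :=
  HB.pack f (isMeasurableFun.Build _ _ _ _ f mf).

Section centered.
Context d (T : measurableType d) (R : realType) (P : probability T R).
Variables (X : R -> {RV P >-> R}) (k : R).

Let measurable_centered s : measurable_fun setT (fun w => k * (X s w - X 0 w))%R.
Proof. by apply: measurable_funM => //; exact: measurable_funB. Qed.

(** The factor [k] is 1 to centre the process and -1 to reflect it as well.
    Subtracting [X 0] makes the process start at zero on every path rather than
    on almost every path, without a change of its increments. *)
Definition centered s : {RV P >-> R} := mk_RV P (measurable_centered s).

Lemma centeredE s w : centered s w = (k * (X s w - X 0 w))%R.
Proof. by []. Qed.

Lemma centered0 w : centered 0%R w = 0%R.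
Proof. by rewrite centeredE subrr mulr0. Qed.

Hypothesis levyX : levy_process X.

Let mk (B : set R) : measurable B -> measurable [set x | B (k * x)%R].
Proof.
move=> mB; have mf : measurable_fun setT (fun x : R => k * x)%R.
  exact: measurable_funM.
by rewrite -[X in measurable X]setTI; exact: mf.
Qed.

Let increment_centered s t B :
  increment centered s t @^-1` B = increment X s t @^-1` [set x | B (k * x)%R].
Proof.
apply/funext => w; rewrite /preimage/= /increment !centeredE.
by congr (B _); ring.
Qed.

Lemma prob_centered s (B : set R) : (0 <= s)%R -> measurable B ->
  P (centered s @^-1` B) = P (X s @^-1` [set x | B (k * x)%R]).
Proof.
move=> s0 mB; have := levy_stationary levyX (lexx 0%R) s0 (mk mB).
by rewrite subr0.
Qed.

Lemma levy_centered : levy_process centered.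
Proof.
split.
- by apply: aeW => w; exact: centered0.
- move=> n t B t0 tm mB.
  under eq_bigcapr do rewrite increment_centered.
  under eq_bigr do rewrite increment_centered.
  by apply: (levy_independent levyX) => // i; exact: mk.
- move=> s t B s0 st mB.
  rewrite increment_centered (levy_stationary levyX)//; last exact: mk.
  by rewrite prob_centered// subr_ge0.
- by move=> w; exact: (cadlag_affine _ _ (levy_cadlag levyX w)).
Qed.

Lemma jump_centered s w : (0 < s)%R ->
  jump (Defs.path centered w) s = (k * jump (Defs.path X w) s)%R.
Proof. by move=> s0; exact: (jump_affine k (X 0 w) (levy_cadlag levyX w) s0). Qed.

End centered.

Section tail_integrals.
Context d (T : measurableType d) (R : realType) (P : probability T R).
Variable X : {RV P >-> R}.

Lemma expectation_pos_part :
  \int[P]_w (Num.max 0 (X w))%:E =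
  \int[lebesgue_measure]_(u in `]0%R, +oo[) P [set w | (u < X w)%R].
Proof.
have mp : measurable_fun setT (fun w => Num.max 0 (X w))%R.
  exact: measurable_maxr.
have := @ge0_expectation_ccdf _ _ _ P (mk_RV P mp).
rewrite expectation_def => -> //=; last by move=> w; rewrite le_max lexx.
rewrite -integral_itv_obnd_cbnd; last first.
  by apply: measurable_funTS; exact: ccdf_measurable.
apply: eq_integral => u; rewrite inE/= in_itv/= andbT => u0.
rewrite /ccdf /distribution /pushforward/=; congr (P _).
apply/seteqP; split => w /=; rewrite in_itv/= andbT lt_max.
  by rewrite [(u < 0)%R]lt_gtF.
by move=> ->; rewrite orbT.
Qed.

Hypothesis no_atom : forall u, P [set w | X w = u] = 0.

Let measurable_level u : measurable [set w | X w = u].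
Proof.
rewrite -[X in measurable X]setTI.
exact: (measurable_funPT X measurableT _ (measurable_set1 u)).
Qed.

Lemma prob_le_lt u : P [set w | (X w <= u)%R] = P [set w | (X w < u)%R].
Proof.
rewrite -[RHS]adde0 -(no_atom u) -measureU; last 3 first.
- exact: measurable_set_lt.
- exact: measurable_level.
- by apply/seteqP; split => // w /= [+ Xu]; rewrite Xu ltxx.
congr (P _); apply/seteqP; split => w /=.
  by rewrite le_eqVlt => /predU1P[|]; [right|left].
by case=> [/ltW//|->].
Qed.

Lemma prob_ge_gt u : P [set w | (u <= X w)%R] = P [set w | (u < X w)%R].
Proof.
rewrite -[RHS]adde0 -(no_atom u) -measureU; last 3 first.
- exact: measurable_set_lt.
- exact: measurable_level.
- by apply/seteqP; split => // w /= [+ Xu]; rewrite Xu ltxx.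
congr (P _); apply/seteqP; split => w /=.
  by rewrite le_eqVlt => /predU1P[|]; [right|left].
by case=> [/ltW//|->].
Qed.

Lemma expectation_neg_part :
  \int[P]_w (Num.max 0 (- X w))%:E =
  \int[lebesgue_measure]_(u in `]-oo, 0%R[) P [set w | (X w <= u)%R].
Proof.
have mp : measurable_fun setT (fun w => Num.max 0 (- X w))%R.
  by apply: measurable_maxr => //; exact: measurableT_comp.
have := @ge0_expectation_ccdf _ _ _ P (mk_RV P mp).
rewrite expectation_def => -> //=; last by move=> w; rewrite le_max lexx.
have mc := ccdf_measurable (mk_RV P mp).
rewrite ge0_integration_by_substitution0//.
rewrite -integral_itv_bndo_bndc; last first.
  apply: measurable_funTS; apply: (measurableT_comp mc).
  exact: oppr_measurable.
apply: eq_integral => u; rewrite inE/= in_itv/= => u0.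
rewrite prob_le_lt /ccdf /distribution /pushforward/=; congr (P _).
apply/seteqP; split => w /=; rewrite in_itv/= andbT lt_max ltrN2.
  by rewrite oppr_lt0 [(0 < u)%R]lt_gtF.
by move=> ->; rewrite orbT.
Qed.

End tail_integrals.

(** * Time reversal and the two formulas *)

Section reversal.
Context d (T : measurableType d) (R : realType) (P : probability T R).
Variable (Z : R -> {RV P >-> R}).
Hypotheses (levyZ : levy_process Z) (posZ : spectrally_positive Z).
Hypothesis Z0 : forall w, Z 0%R w = 0%R.
Variable t : R.
Hypothesis t0 : (0 < t)%R.

(** On the grid the maximum is the endpoint minus the minimum, in law; adding the
    negative part of the endpoint to both sides keeps all terms nonnegative,
    as [Z t] may have an infinite mean. *)
Lemma expected_sup_reversal :
  \int[P]_w depth (centered Z (-1)) t w + mean_neg Z t =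
  \int[P]_w (Num.max 0 (Z t w))%:E + \int[P]_w depth Z t w.
Proof.
pose h n := mesh t n; pose N n := (2 ^ n)%N.
have neg_fin : mean_neg Z t \is a fin_num.
  by apply: (mean_neg_fin levyZ posZ Z0 t0); rewrite lexx ltW.
have depth_fin : \int[P]_w depth Z t w \is a fin_num.
  rewrite ge0_fin_numE; first exact: (expected_depth_lty levyZ posZ Z0 t0).
  by apply: integral_ge0 => w _; exact: (depth_ge0 Z0 t0).
have cN := cvg_expected_depth (levy_centered (-1) levyZ) (@centered0 _ _ _ _ Z (-1)) t0.
have cZ := cvg_expected_depth levyZ Z0 t0.
have cL : \int[P]_w (- low (centered Z (-1)) (h n) (N n) w)%:E + mean_neg Z t
    @[n --> \oo] --> \int[P]_w depth (centered Z (-1)) t w + mean_neg Z t.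
  by apply: cvgeD => //; [exact: fin_num_adde_defl|exact: cvg_cst].
have cR : \int[P]_w (Num.max 0 (Z t w))%:E + \int[P]_w (- low Z (h n) (N n) w)%:E
    @[n --> \oo] --> \int[P]_w (Num.max 0 (Z t w))%:E + \int[P]_w depth Z t w.
  by apply: cvgeD => //; [exact: fin_num_adde_defl|exact: cvg_cst].
have mJ (W : R -> {RV P >-> R}) n : measurable_fun setT (fun w => (- low W (h n) (N n) w)%:E).
  by apply/measurable_EFinP; apply: measurableT_comp => //; exact: measurable_low.
have mp : measurable_fun setT (fun w => (Num.max 0 (Z t w))%:E).
  by apply/measurable_EFinP; exact: measurable_maxr.
have mn : measurable_fun setT (fun w => (neg_part Z t w)%:E).
  by apply/measurable_EFinP; exact: measurable_neg_part.
rewrite -(cvg_lim (@ereal_hausdorff R) cL) -(cvg_lim (@ereal_hausdorff R) cR).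
congr (lim (_ @ \oo)).
apply/funext => n.
have -> : \int[P]_w (- low (centered Z (-1)) (mesh t n) (2 ^ n) w)%:E =
    \int[P]_w (Z t w - low Z (h n) (N n) w)%:E.
  have h0 : (0 <= mesh t n)%R by exact/ltW/mesh_gt0.
  have := expected_max_min (levy_independent levyZ) (levy_stationary levyZ) Z0 h0 (N n).
  have -> : (fun w => (sample Z (mesh t n) (N n) w - low Z (mesh t n) (N n) w)%:E) =
      (fun w => (Z t w - low Z (h n) (N n) w)%:E).
    by apply/funext => w; rewrite /sample mesh_last.
  move=> <-; apply: eq_integral => w _; congr (- _)%:E.
  apply: eq_running_min => i _.
  by rewrite /sample centeredE Z0 subr0 mulN1r.
have JZ w : (low Z (h n) (N n) w <= Z t w)%R.
  have := running_min_le (fun i => sample Z (h n) i w) (leqnn (N n)).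
  by rewrite /sample mesh_last.
rewrite -ge0_integralD//; last 3 first.
- by move=> w _; rewrite lee_fin subr_ge0.
- apply/measurable_EFinP; apply: measurable_funB => //; exact: measurable_low.
- by move=> w _; rewrite lee_fin neg_part_ge0.
rewrite -ge0_integralD//; last 2 first.
- by move=> w _; rewrite lee_fin le_max lexx.
- by move=> w _; rewrite lee_fin oppr_ge0 low_le0.
apply: eq_integral => w _; rewrite -!EFinD; congr (_%:E); rewrite /neg_part.
by have [?|?] := leP 0%R (Z t w); have [?|?] := leP 0%R (- Z t w)%R; lra.
Qed.

End reversal.

Section transfer.
Context d (T : measurableType d) (R : realType) (P : probability T R).

Lemma integral_running_sup (X Z : R -> {RV P >-> R}) t : (0 < t)%R ->
  levy_process X -> levy_process Z ->
  (forall w, X 0%R w = 0%R -> forall s, (- Z s w)%R = X s w) ->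
  \int[P]_w running_sup X t w = \int[P]_w depth Z t w.
Proof.
move=> t0 levyX levyZ ZX; apply: ae_eq_integral => //.
- have cX w : cadlag (fun s => -1 * (X s w - 0))%R.
    exact: (cadlag_affine _ _ (levy_cadlag levyX w)).
  apply: (@emeasurable_fun_cvg _ _ _ _
    (fun n w => (- grid_min t (fun s => -1 * (X s w - 0))%R n)%:E)).
    move=> n; apply/measurable_EFinP; apply: measurableT_comp => //.
    apply: measurable_running_min => i; apply: measurable_funM => //.
    exact: measurable_funB.
  move=> w _; have := cvg_grid_min t0 (cX w).
  rewrite /running_sup.
  by under eq_imagel do rewrite subr0 mulN1r opprK.
- exact: (measurable_depth levyZ t0).
- apply: filterS (levy_start levyX) => w X0 _.
  rewrite /running_sup /depth; congr (ereal_sup _).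
  by apply: eq_imagel => s _; rewrite ZX.
Qed.

Lemma prob_set1_eq0 (X : {RV P >-> R}) u :
  distribution P X `<< lebesgue_measure -> P [set w | X w = u] = 0.
Proof.
move=> /null_content_dominatesP ac.
exact: (ac [set u] (measurable_set1 u) (lebesgue_measure_set1 u)).
Qed.

Lemma sup_formula_positive (X : R -> {RV P >-> R}) t :
  levy_process X -> spectrally_positive X ->
  (forall s, (0 < s)%R -> distribution P (X s) `<< lebesgue_measure) ->
  (0 < t)%R ->
  \int[P]_w running_sup X t w =
    \int[lebesgue_measure]_(u in `]0%R, +oo[) P [set w | (X t w > u)%R] +
    \int[lebesgue_measure]_(s in `]0%R, t[)
      (P [set w | (X (t - s)%R w > 0)%R] * (s^-1)%:E *
       \int[lebesgue_measure]_(u in `]-oo, 0%R[) P [set w | (X s w <= u)%R]).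
Proof.
move=> levyX posX acX t0; pose Z := centered X 1.
have levyZ : levy_process Z := levy_centered 1 levyX.
have Z0 : forall w, Z 0%R w = 0%R := @centered0 _ _ _ _ X 1.
have posZ : spectrally_positive Z.
  by apply: filterS posX => w pos s s0; rewrite jump_centered// mul1r pos.
have lawZ s (B : set R) : (0 <= s)%R -> measurable B ->
    P (Z s @^-1` B) = P (X s @^-1` B).
  move=> s0 mB; rewrite prob_centered//; congr (P _); apply/funext => w.
  by rewrite /preimage/= mul1r.
have no_atom s u : (0 < s)%R -> P [set w | Z s w = u] = 0.
  move=> s0; rewrite -(prob_set1_eq0 u (acX s s0)).
  exact: (lawZ s [set u] (ltW s0) (measurable_set1 u)).
have no_atom0 s s0 := no_atom s 0%R s0.
have meanE s : (0 < s)%R -> mean_neg Z s =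
    \int[lebesgue_measure]_(u in `]-oo, 0%R[) P [set w | (X s w <= u)%R].
  move=> s0; rewrite /mean_neg expectation_neg_part => [|u]; last exact: no_atom.
  apply: eq_integral => u _.
  have := lawZ s `]-oo, u]%classic (ltW s0) (measurable_itv _).
  by rewrite !preimage_itvNyc.
have [mrate E] := expected_depthE levyZ posZ Z0 no_atom0 t0.
have neg_fin : mean_neg Z t \is a fin_num.
  by apply: (mean_neg_fin levyZ posZ Z0 t0); rewrite lexx ltW.
rewrite (integral_running_sup t0 levyX (levy_centered (-1) levyZ)); last first.
  by move=> w X0 s; rewrite !centeredE X0; ring.
have := expected_sup_reversal levyZ posZ Z0 t0.
rewrite E addeCA addeC [in RHS]addeC => /(congr1 (fun x => x - mean_neg Z t)).
rewrite [mean_neg Z t + _]addeC !addeK// => ->; congr (_ + _).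
  rewrite expectation_pos_part; apply: eq_integral => u _.
  have := lawZ t `]u, +oo[%classic (ltW t0) (measurable_itv _).
  by rewrite !preimage_itvoy.
apply: eq_integral => s; rewrite inE/= in_itv/= => /andP[s0 st].
rewrite -meanE// /rate !EFinM !fineK ?prob_pos_fin//; last first.
  by apply: (mean_neg_fin levyZ posZ Z0 t0); rewrite !ltW.
congr (_ * _ * _); rewrite /prob_pos.
have ts0 : (0 <= t - s)%R by rewrite subr_ge0 ltW.
have := lawZ (t - s)%R `]0%R, +oo[%classic ts0 (measurable_itv _).
by rewrite !preimage_itvoy.
Qed.

Lemma sup_formula_negative (Y : R -> {RV P >-> R}) t :
  levy_process Y -> spectrally_negative Y ->
  (forall s, (0 < s)%R -> distribution P (Y s) `<< lebesgue_measure) ->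
  (0 < t)%R ->
  \int[P]_w running_sup Y t w =
    \int[lebesgue_measure]_(u in `]0%R, +oo[) P [set w | (Y t w > u)%R] +
    \int[lebesgue_measure]_(s in `]0%R, t[)
      (P [set w | (Y (t - s)%R w < 0)%R] * (s^-1)%:E *
       \int[lebesgue_measure]_(u in `]0%R, +oo[) P [set w | (Y s w >= u)%R]).
Proof.
move=> levyY negY acY t0; pose Z := centered Y (-1).
have levyZ : levy_process Z := levy_centered (-1) levyY.
have Z0 : forall w, Z 0%R w = 0%R := @centered0 _ _ _ _ Y (-1).
have posZ : spectrally_positive Z.
  by apply: filterS negY => w neg s s0; rewrite jump_centered// mulN1r oppr_ge0 neg.
have atomY s u : (0 < s)%R -> P [set w | Y s w = u] = 0.
  by move=> s0; exact: prob_set1_eq0 (acY s s0).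
have no_atom0 s : (0 < s)%R -> P [set w | Z s w = 0%R] = 0.
  move=> s0; rewrite -(atomY s 0%R s0).
  have := prob_centered (-1) levyY (ltW s0) (measurable_set1 0%R).
  rewrite -[P [set w | Z s w = _]]/(P (centered Y (-1) s @^-1` [set 0%R])) => ->.
  congr (P _); apply/seteqP; split => w /=; rewrite mulN1r.
    by move/eqP; rewrite oppr_eq0 => /eqP.
  by move=> ->; rewrite oppr0.
have meanE s : (0 < s)%R -> mean_neg Z s =
    \int[lebesgue_measure]_(u in `]0%R, +oo[) P [set w | (Y s w > u)%R].
  move=> s0; rewrite /mean_neg.
  transitivity (\int[P]_w (Num.max 0 (centered Y 1 s w))%:E).
    apply: eq_integral => w _; rewrite /neg_part !centeredE; congr (Num.max 0 _)%:E.
    by ring.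
  rewrite expectation_pos_part; apply: eq_integral => u _.
  have := prob_centered 1 levyY (ltW s0) (measurable_itv `]u, +oo[).
  rewrite preimage_itvoy => ->; congr (P _); apply/seteqP.
  by split => w /=; rewrite in_itv/= andbT mul1r.
have [mrate E] := expected_depthE levyZ posZ Z0 no_atom0 t0.
rewrite (integral_running_sup t0 levyY levyZ); last first.
  by move=> w Y0 s; rewrite centeredE Y0; ring.
rewrite E meanE//; congr (_ + _).
apply: eq_integral => s; rewrite inE/= in_itv/= => /andP[s0 st].
rewrite /rate !EFinM !fineK ?prob_pos_fin//; last first.
  by apply: (mean_neg_fin levyZ posZ Z0 t0); rewrite !ltW.
rewrite meanE//; congr (_ * _ * _).
  have ts0 : (0 <= t - s)%R by rewrite subr_ge0 ltW.
  have := prob_centered (-1) levyY ts0 (measurable_itv `]0%R, +oo[).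
  rewrite preimage_itvoy /prob_pos => ->; congr (P _); apply/seteqP.
  by split => w /=; rewrite in_itv/= andbT mulN1r oppr_gt0.
apply: eq_integral => u _; apply/esym/prob_ge_gt => v; exact: atomY.
Qed.

End transfer.

Theorem proposition1 (R : realType) (d : measure_display)
  (T : measurableType d) (P : probability T R) (X Y : R -> {RV P >-> R})
  (bX sigma2X bY sigma2Y : R) (nuX nuY : {measure set R -> \bar R})
  (levyX : levy_process X) (levyY : levy_process Y)
  (posX : spectrally_positive X) (negY : spectrally_negative Y)
  (ivX : infinite_variation X) (ivY : infinite_variation Y)
  (tripletX : levy_triplet X bX sigma2X nuX)
  (tripletY : levy_triplet Y bY sigma2Y nuY)
  (no_gaussX : sigma2X = 0%R) (no_gaussY : sigma2Y = 0%R)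
  (densX : bounded_density_off_zero nuX)
  (densY : bounded_density_off_zero nuY)
  (acX : forall s : R, (0 < s)%R -> distribution P (X s) `<< lebesgue_measure)
  (acY : forall s : R, (0 < s)%R -> distribution P (Y s) `<< lebesgue_measure)
  (t : R) (t_gt0 : (0 < t)%R) :
  \int[P]_w running_sup X t w =
    \int[lebesgue_measure]_(u in `]0%R, +oo[) P [set w | (X t w > u)%R] +
    \int[lebesgue_measure]_(s in `]0%R, t[)
      (P [set w | (X (t - s)%R w > 0)%R] * (s^-1)%:E *
       \int[lebesgue_measure]_(u in `]-oo, 0%R[) P [set w | (X s w <= u)%R])
  /\
  ('E_P[fun w => (- Num.min (Y t w) 0)%R] < +oo ->
   \int[P]_w running_sup Y t w =
    \int[lebesgue_measure]_(u in `]0%R, +oo[) P [set w | (Y t w > u)%R] +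
    \int[lebesgue_measure]_(s in `]0%R, t[)
      (P [set w | (Y (t - s)%R w < 0)%R] * (s^-1)%:E *
       \int[lebesgue_measure]_(u in `]0%R, +oo[) P [set w | (Y s w >= u)%R])).
Proof.
split=> [|_]; first exact: sup_formula_positive.
exact: sup_formula_negative.
Qed.
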